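(* If $(w_1,w_2)$ and $(v_1,v_2)$ are any two critical points of $\mathcal{G}$ in $\mathcal{M}_{\rho^-,\rho^+}\times\mathcal{M}_{\rho^+,\rho^-}$, then there is an $a\in\mathbb{R}$ so that $$(v_1(x),v_2(x))=(w_1(x-a),w_2(x-a))\quad\text{for all }x\in\mathbb{R}.$$ Thus, there is exactly one critical point $(w_1,w_2)$ of $\mathcal{G}$ in $\mathcal{M}_{\rho^-,\rho^+}\times\mathcal{M}_{\rho^+,\rho^-}$ such that $w_1(0)=w_2(0)$. It is symmetric in the sense that $w_1(x)=w_2(-x)$ for all $x\in\mathbb{R}$.
   Context: Setting. $J:[0,\infty)\to[0,\infty)$ is decreasing (non-increasing) and compactly supported; for a dimension $\nu\ge1$ put $\bar J(s)=\int_{\mathbb{R}^{\nu-1}}J(\sqrt{s^2+|t|^2})\,dt$ for $s\in\mathbb{R}$ (with $\bar J(s)=J(|s|)$ if $\nu=1$) and $\hat J=\int_{\mathbb{R}}\bar J(s)\,ds$. Fix $\kappa\in\mathbb{R}$ (the chemical potential) and $\beta>0$, and for $m,n\ge0$ let $$f(m,n)=m\ln m+n\ln n+\beta\hat J\,mn-\kappa m-\kappa n\qquad(0\ln 0=0),\qquad g=\inf_{m,n\ge0}f(m,n).$$ There is a critical value $\beta_c$ such that $f$ has a unique minimizer for $\beta\le\beta_c$, while for $\beta>\beta_c$ there are densities $\rho^-<\rho^+$ such that the minimizers of $f$ are exactly $(\rho^+,\rho^-)$ and $(\rho^-,\rho^+)$. It is assumed that $\beta>\beta_c$. The excess free energy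 functional is $$\mathcal{G}(m,n)=\int_{\mathbb{R}}\Big[m(x)\ln m(x)+n(x)\ln n(x)-\kappa m(x)-\kappa n(x)+\beta\int_{\mathbb{R}}\bar J(x-y)m(x)n(y)\,dy-g\Big]dx.$$ $\mathcal{M}_{\rho^-,\rho^+}$ is the set of right-continuous monotone increasing functions on $\mathbb{R}$ with limits $\rho^-$ at $-\infty$ and $\rho^+$ at $+\infty$; $\mathcal{M}_{\rho^+,\rho^-}$ is the set of right-continuous monotone decreasing functions on $\mathbb{R}$ with limits $\rho^+$ at $-\infty$ and $\rho^-$ at $+\infty$. A critical point of $\mathcal{G}$ in $\mathcal{M}_{\rho^-,\rho^+}\times\mathcal{M}_{\rho^+,\rho^-}$ is a pair $(m,n)$ in this set satisfying the Euler–Lagrange equations $$\ln m(x)+\beta(\bar J*n)(x)=\kappa-1,\qquad \ln n(x)+\beta(\bar J*m)(x)=\kappa-1\qquad(x\in\mathbb{R}),$$ where $*$ denotes convolution on $\mathbb{R}$. *)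

(* Defs.v *)
From HB Require Import structures.
From mathcomp Require Import all_boot all_order all_algebra.
From mathcomp Require Import all_classical all_reals all_analysis.
Set Implicit Arguments.
Unset Strict Implicit.
Unset Printing Implicit Defensive.
Import Order.TTheory GRing.Theory Num.Theory.
Import numFieldNormedType.Exports.

Local Open Scope classical_set_scope.
Local Open Scope ring_scope.

(** Lebesgue measure on [R^k], realised on [k.-tuple R]: the product measure is
    carried along [(x, t) |-> x :: t]. For [k = 0] it is the unit mass on the
    one-point space [R^0]. *)
Section lebesgue_tuple.
Context {R : realType}.
Notation T := (measurableTypeR R).

Definition cons_pair (k : nat) (xt : T * k.-tuple T) : k.+1.-tuple T :=
  [tuple of xt.1 :: xt.2].

Lemma measurable_cons_pair k : measurable_fun [set: T * k.-tuple T] (@cons_pair k).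
Proof. exact: (measurable_cons measurable_fst measurable_snd). Qed.

Section lebesgue_cons.
Context (k : nat) (m : {sigma_finite_measure set (k.-tuple T) -> \bar R}).

Definition lebesgue_cons : set (k.+1.-tuple T) -> \bar R :=
  pushforward (@lebesgue_measure R \x m)%E (@cons_pair k).

Let lebesgue_cons0 : lebesgue_cons set0 = 0%E.
Proof. by rewrite /lebesgue_cons /pushforward preimage_set0 measure0. Qed.

Let lebesgue_cons_ge0 A : (0 <= lebesgue_cons A)%E.
Proof. exact: (measure_ge0 (@lebesgue_measure R \x m)%E). Qed.

Let lebesgue_cons_sigma_additive : semi_sigma_additive lebesgue_cons.
Proof.
move=> F mF tF mUF; rewrite /lebesgue_cons /pushforward preimage_bigcup.
have mpre A : measurable A -> measurable (@cons_pair k @^-1` A).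
  by move=> mA; rewrite -[X in measurable X]setTI; exact: measurable_cons_pair.
apply: measure_semi_sigma_additive.
- by move=> n; exact: mpre.
- apply/trivIsetP => /= i j _ _ ij; rewrite -preimage_setI.
  by move/trivIsetP : tF => /(_ _ _ _ _ ij) ->//; rewrite preimage_set0.
- by rewrite -preimage_bigcup; exact: mpre.
Qed.

HB.instance Definition _ := isMeasure.Build _ _ _ lebesgue_cons
  lebesgue_cons0 lebesgue_cons_ge0 lebesgue_cons_sigma_additive.

Let lebesgue_cons_sigma_finite : sigma_finite setT lebesgue_cons.
Proof.
have /sigma_finiteP[F [TF ndF Foo]] := sigma_finiteT (@lebesgue_measure R).
have /sigma_finiteP[G [TG ndG Goo]] := sigma_finiteT m.
pose uncons (t : k.+1.-tuple T) : T * k.-tuple T := (thead t, [tuple of behead t]).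
have unconsK : cancel (@cons_pair k) uncons.
  by move=> [x t]; congr (_, _); apply/val_inj.
have muncons : measurable_fun setT uncons.
  apply/measurable_fun_pair; first exact: measurable_tnth.
  exact: measurable_behead.
exists (fun i => uncons @^-1` (F i `*` G i)).
  apply/esym; rewrite -subTset => t _.
  have : [set: T] (thead t) by [].
  rewrite TF => -[i _ Fit].
  have : [set: k.-tuple T] [tuple of behead t] by [].
  rewrite TG => -[j _ Gjt].
  exists (maxn i j) => //; split => /=.
    by move: Fit; exact/subsetPset/ndF/leq_maxl.
  by move: Gjt; exact/subsetPset/ndG/leq_maxr.
move=> i; have [mF Fioo] := Foo i; have [mG Gioo] := Goo i; split.
  by rewrite -[X in measurable X]setTI; apply: muncons => //; exact: measurableX.
rewrite /lebesgue_cons /pushforward -comp_preimage.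
rewrite (_ : uncons \o @cons_pair k = id); last first.
  by rewrite funeqE => xt; exact: unconsK.
by rewrite preimage_id product_measure1E// lte_mul_pinfty// ge0_fin_numE.
Qed.

HB.instance Definition _ := Measure_isSigmaFinite.Build _ _ _ lebesgue_cons
  lebesgue_cons_sigma_finite.

End lebesgue_cons.

Fixpoint lebesgue_tuple (k : nat) :
    {sigma_finite_measure set (k.-tuple T) -> \bar R} :=
  match k with
  | 0 => \d_([tuple] : 0.-tuple T)
  | k'.+1 => lebesgue_cons (lebesgue_tuple k')
  end.

End lebesgue_tuple.

Section model.
Context {R : realType}.
Notation mu := (@lebesgue_measure R).

(** [J] is only meaningful on [[0, +oo[]; its values at negative reals are
    unconstrained and never used. *)
Definition admissible_kernel (J : R -> R) : Prop :=
  [/\ forall r : R, 0 <= r -> 0 <= J r,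
      {in `[0, +oo[ &, nonincreasing_fun J} &
      exists A : R, forall r : R, 0 <= r -> A < r -> J r = 0].

Definition Jbar (J : R -> R) (nu : nat) (s : R) : R :=
  (\int[lebesgue_tuple nu.-1]_t
     J (Num.sqrt (s ^+ 2 + \sum_(i < nu.-1) tnth t i ^+ 2)))%R.

Definition Jhat (J : R -> R) (nu : nat) : R := (\int[mu]_s Jbar J nu s)%R.

(** At [m = 0] the library convention [ln 0 = 0] gives [0 ln 0 = 0]. *)
Definition free_energy (J : R -> R) (nu : nat) (kappa beta m n : R) : R :=
  m * ln m + n * ln n + beta * Jhat J nu * m * n - kappa * m - kappa * n.

Definition minimizer (J : R -> R) (nu : nat) (kappa beta : R) (p : R * R) : Prop :=
  [/\ 0 <= p.1, 0 <= p.2 &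
      forall m n : R, 0 <= m -> 0 <= n ->
        free_energy J nu kappa beta p.1 p.2 <= free_energy J nu kappa beta m n].

Definition two_phase_densities (J : R -> R) (nu : nat) (kappa beta rhom rhop : R)
    : Prop :=
  rhom < rhop /\
  forall p, minimizer J nu kappa beta p <-> p = (rhop, rhom) \/ p = (rhom, rhop).

Definition critical_beta (J : R -> R) (nu : nat) (kappa betac : R) : Prop :=
  (forall beta : R, 0 < beta -> beta <= betac ->
     exists! p, minimizer J nu kappa beta p) /\
  (forall beta : R, 0 < beta -> betac < beta ->
     exists rhom rhop : R, two_phase_densities J nu kappa beta rhom rhop).

Definition convolution (K h : R -> R) (x : R) : R := (\int[mu]_y (K (x - y) * h y))%R.

Definition incr_profile (a b : R) : set (R -> R) :=
  [set m : R -> R | [/\ right_continuous m, nondecreasing_fun m,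
               m @ -oo --> a & m @ +oo --> b]].

Definition decr_profile (a b : R) : set (R -> R) :=
  [set n : R -> R | [/\ right_continuous n, nonincreasing_fun n,
               n @ -oo --> a & n @ +oo --> b]].

Definition euler_lagrange (J : R -> R) (nu : nat) (kappa beta : R) (m n : R -> R)
    : Prop :=
  forall x, ln (m x) + beta * convolution (Jbar J nu) n x = kappa - 1 /\
            ln (n x) + beta * convolution (Jbar J nu) m x = kappa - 1.

Definition critical_point (J : R -> R) (nu : nat) (kappa beta rhom rhop : R)
    (w : (R -> R) * (R -> R)) : Prop :=
  [/\ incr_profile rhom rhop w.1, decr_profile rhop rhom w.2 &
      euler_lagrange J nu kappa beta w.1 w.2].

End model.

(* Main.v *)
Require Import Defs.
From HB Require Import structures.
From mathcomp Require Import all_boot all_order all_algebra.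
From mathcomp Require Import all_classical all_reals all_analysis.
From mathcomp Require Import measurable_realfun ring lra.
Import Order.TTheory GRing.Theory Num.Theory.
Import numFieldNormedType.Exports.
Local Open Scope classical_set_scope.
Local Open Scope ring_scope.

(** Put c = kappa - 1, K = Jbar, alpha = beta * Jhat, and let the response of a
    profile h be Phi(h) = exp(c - beta (K * h)). The Euler-Lagrange equations say
    m = Phi(n) and n = Phi(m). Since K >= 0, Phi reverses the pointwise order, so
    the system is monotone for the order in which m increases and n decreases,
    and it commutes with translations and with the flip (m, n) -> (n(-x), m(-x)),
    K being even. The constant states (rhom, rhop) and (rhop, rhom) are fixed.

    Uniqueness is a sliding argument. Given two critical points v and w, translate
    w far to the left, so that w.1(. + a) >= v.1 and w.2(. + a) <= v.2 hold on a
    large interval. They then hold everywhere: outside the interval the positive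
    parts P and Q of v.1 - w.1(. + a) and w.2(. + a) - v.2 satisfy P <= p beta (K * Q) and
    Q <= q beta (K * P) with alpha^2 p q < 1, and a supremum argument makes them
    vanish ([coupled_subsolution_eq0], [comparison_from_core]). The needed
    inequality alpha^2 rhom rhop < 1 says that the logarithmic mean of rhom and
    rhop, which is 1 / alpha by the equations for the constant states, exceeds
    their geometric mean ([log_mean_gt_geometric_mean]). At the smallest
    admissible a the two solutions touch, otherwise a could be decreased further,
    and two ordered solutions that touch at one point coincide, because K > 0 near
    0 ([strong_comparison], [front_unique]).

    Existence uses that, for fixed n, the profile Phi(n) is the minimizer of the
    excess free energy in m. Alternating minimization, started from the step
    profile, is the iteration of u -> Phi(u)(-x) ([relax]); all iterates are
    monotone and equal to rhom or rhop far away, so that every energy is an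
    integral over a bounded set. The energy decreases by at least a multiple of
    the squared L2 norm of the change ([energy_dissipation]) and is nonnegative
    ([energy_ge0]): both follow from writing the interaction of m and n as a
    double integral of K(x - y)(m(x) - m(y))(n(y) - n(x)), which is symmetric in
    m and n, and nonnegative for oppositely monotone profiles. Hence consecutive
    changes tend to 0, uniformly because the iterates are equi-Lipschitz. Translating
    each iterate so that its two components cross at 0 and passing to a limit gives
    m = Phi(n), n = Phi(m) and m(0) = n(0). The bound on the energy forces the limits
    at infinity to be minimizers of the free energy density, that is, the two phases,
    and m(0) = n(0) tells which one is on which side ([tail_limit],
    [front_from_approximants]).

    A solution is strictly monotone, so its components cross only once; this
    singles out one translate, and the flip of that translate, being again a
    solution with crossing point 0, equals it. *)

(** * Integrals of bounded functions with bounded support *)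

Section integration.
Context {R : realType}.
Notation mu := (@lebesgue_measure R).

Definition bounded_measurable (h : R -> R) : Prop :=
  measurable_fun [set: R] h /\ exists M : R, forall x : R, `|h x| <= M.

(** Names in tf refer to this class, those in bm to the preceding one. It is
    closed under all the operations used here and all its members are integrable,
    so that the Lebesgue integral on it is a plain linear monotone functional. *)
Definition test_fun (f : R -> R) : Prop :=
  bounded_measurable f /\ exists L : R, forall x : R, L < `|x| -> f x = 0.

Lemma bounded_support_integrable d (T : measurableType d)
    (nu : {measure set T -> \bar R}) (B : set T) (M : R) (f : T -> R) :
  measurable B -> (nu B < +oo)%E -> measurable_fun setT f ->
  (forall x, `|f x| <= M) -> (forall x, ~ B x -> f x = 0) ->
  nu.-integrable setT (EFin \o f).
Proof.
move=> mB Boo mf fM fB.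
have : nu.-integrable B (EFin \o f).
  apply: measurable_bounded_integrable.
  - exact: mB.
  - exact: Boo.
  - exact: measurable_funTS.
  - exists M; split; first exact: num_real.
    by move=> N MN x _ /=; rewrite (le_trans (fM x))// ltW.
rewrite integrable_mkcond//; apply: le_integrable => //; first by apply/measurable_EFinP.
move=> x _ /=; rewrite patchE; case: ifPn => //; rewrite notin_setE => nB.
by rewrite fB.
Qed.

Lemma bm_cst (c : R) : bounded_measurable (fun=> c).
Proof. by split; [exact: measurable_cst|exists `|c|]. Qed.

Lemma bmD f g : bounded_measurable f -> bounded_measurable g ->
  bounded_measurable (fun x => f x + g x).
Proof.
move=> [mf [M fM]] [mg [N gN]]; split; first exact: measurable_funD.
by exists (M + N) => x; rewrite (le_trans (ler_normD _ _))// lerD.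
Qed.

Lemma bmM f g : bounded_measurable f -> bounded_measurable g ->
  bounded_measurable (fun x => f x * g x).
Proof.
move=> [mf [M fM]] [mg [N gN]]; split; first exact: measurable_funM.
by exists (M * N) => x; rewrite normrM ler_pM.
Qed.

Lemma bmN f : bounded_measurable f -> bounded_measurable (fun x => - f x).
Proof.
move=> [mf [M fM]]; split; first exact: measurableT_comp.
by exists M => x; rewrite normrN.
Qed.

Lemma bmB f g : bounded_measurable f -> bounded_measurable g ->
  bounded_measurable (fun x => f x - g x).
Proof. by move=> bf bg; apply: bmD => //; exact: bmN. Qed.

Lemma bm_shift f a : bounded_measurable f -> bounded_measurable (fun x => f (x + a)).
Proof.
move=> [mf [M fM]]; split; last by exists M.
by apply: (measurableT_comp mf); exact: measurable_funD.
Qed.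

Lemma bm_opp f : bounded_measurable f -> bounded_measurable (fun x => f (- x)).
Proof.
move=> [mf [M fM]]; split; last by exists M.
by apply: (measurableT_comp mf); exact: oppr_measurable.
Qed.

Lemma bm_subl f a : bounded_measurable f -> bounded_measurable (fun x => f (a - x)).
Proof.
move=> bf; have := bm_opp _ (bm_shift _ a bf); congr bounded_measurable.
by apply/funext => x; rewrite addrC.
Qed.

Lemma bm_nondecreasing f a b : nondecreasing_fun f -> (forall x, a <= f x <= b) ->
  bounded_measurable f.
Proof.
move=> ndf fab; split; first exact: nondecreasing_measurable.
exists (`|a| + `|b|) => x; have /andP[af fb] := fab x.
have := ler_norm b; have := ler_norm (- a); have := normr_ge0 a; have := normr_ge0 b.
by rewrite normrN ler_norml => ? ? ? ?; apply/andP; split; lra.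
Qed.

Lemma bm_nonincreasing f a b : nonincreasing_fun f -> (forall x, a <= f x <= b) ->
  bounded_measurable f.
Proof.
move=> nf fab.
have : bounded_measurable (fun x => - f x).
  apply: (@bm_nondecreasing _ (- b) (- a)) => [x y xy|x]; first by rewrite lerN2 nf.
  by have /andP[] := fab x; rewrite !lerN2 => -> ->.
move/bmN; congr bounded_measurable; by apply/funext => x; rewrite opprK.
Qed.

Lemma tfM f g : test_fun f -> bounded_measurable g -> test_fun (fun x => f x * g x).
Proof.
move=> [bf [L fL]] bg; split; first exact: bmM.
by exists L => x xL; rewrite fL// mul0r.
Qed.

Lemma tfMl f g : bounded_measurable f -> test_fun g -> test_fun (fun x => f x * g x).
Proof.
move=> bf tg; have := tfM _ _ tg bf; congr test_fun.
by apply/funext => x; rewrite mulrC.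
Qed.

Lemma tfZ c f : test_fun f -> test_fun (fun x => c * f x).
Proof. by move=> tf; apply: tfMl => //; exact: bm_cst. Qed.

Lemma tfD f g : test_fun f -> test_fun g -> test_fun (fun x => f x + g x).
Proof.
move=> [bf [L fL]] [bg [M gM]]; split; first exact: bmD.
exists (Num.max L M) => x; rewrite gt_max => /andP[xL xM].
by rewrite fL// gM// addr0.
Qed.

Lemma tfN f : test_fun f -> test_fun (fun x => - f x).
Proof.
move=> [bf [L fL]]; split; first exact: bmN.
by exists L => x xL; rewrite fL// oppr0.
Qed.

Lemma tfB f g : test_fun f -> test_fun g -> test_fun (fun x => f x - g x).
Proof. by move=> tf tg; apply: tfD => //; exact: tfN. Qed.

Lemma tf_shift f a : test_fun f -> test_fun (fun x => f (x + a)).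
Proof.
move=> [bf [L fL]]; split; first exact: bm_shift.
exists (L + `|a|) => x xL; apply: fL.
have := ler_normB (x + a) a; rewrite addrK; lra.
Qed.

Lemma tf_opp f : test_fun f -> test_fun (fun x => f (- x)).
Proof.
move=> [bf [L fL]]; split; first exact: bm_opp.
by exists L => x xL; apply: fL; rewrite normrN.
Qed.

Lemma tf_subl f a : test_fun f -> test_fun (fun x => f (a - x)).
Proof.
move=> bf; have := tf_opp _ (tf_shift _ a bf); congr test_fun.
by apply/funext => x; rewrite addrC.
Qed.

Lemma tf_integrable f : test_fun f -> mu.-integrable setT (EFin \o f).
Proof.
move=> [[mf [M fM]] [L fL]].
apply: (bounded_support_integrable _ _ mu `[- L, L]%classic M) => //.
- by rewrite /= lebesgue_measure_itv/=; case: ifP => _; rewrite ltry.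
- move=> x; rewrite /= in_itv /= => /negP; rewrite -ler_norml -ltNge; exact: fL.
Qed.

Lemma tf_integralD f g : test_fun f -> test_fun g ->
  (\int[mu]_x (f x + g x) = \int[mu]_x f x + \int[mu]_x g x)%R.
Proof. by move=> tf tg; rewrite RintegralD//; exact: tf_integrable. Qed.

Lemma tf_integralB f g : test_fun f -> test_fun g ->
  (\int[mu]_x (f x - g x) = \int[mu]_x f x - \int[mu]_x g x)%R.
Proof. by move=> tf tg; rewrite RintegralB//; exact: tf_integrable. Qed.

Lemma tf_integralZ c f : test_fun f -> (\int[mu]_x (c * f x) = c * \int[mu]_x f x)%R.
Proof. by move=> tf; rewrite RintegralZl//; exact: tf_integrable. Qed.

Lemma le_tf_integral f g : test_fun f -> test_fun g -> (forall x, f x <= g x) ->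
  (\int[mu]_x f x <= \int[mu]_x g x)%R.
Proof. by move=> tf tg fg; apply: le_Rintegral => //; exact: tf_integrable. Qed.

(** The image of Lebesgue measure under a translation gives every half-open
    interval its length, hence is Lebesgue measure. *)
Lemma tf_integral_shift f a : test_fun f -> (\int[mu]_x f (x + a) = \int[mu]_x f x)%R.
Proof.
move=> tf; congr fine.
pose phi : measurableTypeR R -> measurableTypeR R := fun x => x + a.
have mphi : measurable_fun setT phi by exact: measurable_funD.
have E A : measurable A -> mu A = pushforward mu phi A.
  apply: (@lebesgue_measure_unique R (pushforward mu phi)).
  move=> _ [[u v]] _ <-; rewrite /pushforward /=.
  transitivity (mu `](u - a), (v - a)]%classic).
    rewrite !lebesgue_measure_itv/= !lte_fin ltrD2r; case: ifP => // _.
    by rewrite -!EFinD; congr EFin; ring.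
  congr (mu _).
  by apply/seteqP; split => x /=; rewrite !in_itv /= ltrBlDr lerBrDr.
transitivity (\int[pushforward mu phi]_x (f x)%:E)%E.
  rewrite (@integral_pushforward _ _ _ _ _ _ mphi mu setT (EFin \o f))//.
  - by apply/measurable_EFinP; case: tf => -[].
  - by rewrite preimage_setT; apply: tf_integrable; exact: tf_shift.
by apply: eq_measure_integral => A mA _; exact: esym (E A mA).
Qed.

Lemma tf_integral_opp f : test_fun f -> (\int[mu]_x f (- x) = \int[mu]_x f x)%R.
Proof.
move=> tf; congr fine.
have mphi : measurable_fun setT (-%R : measurableTypeR R -> measurableTypeR R).
  exact: oppr_measurable.
transitivity (\int[pushforward mu (-%R : measurableTypeR R -> measurableTypeR R)]_x (f x)%:E)%E.
  rewrite (@integral_pushforward _ _ _ _ _ _ mphi mu setT (EFin \o f))//.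
  - by apply/measurable_EFinP; case: tf => -[].
  - by rewrite preimage_setT; apply: tf_integrable; exact: tf_opp.
by apply: eq_measure_integral => A mA _; exact: lebesgue_measureN.
Qed.

Lemma tf_integral_subl f a : test_fun f -> (\int[mu]_x f (a - x) = \int[mu]_x f x)%R.
Proof.
move=> tf; rewrite -(tf_integral_opp (fun x => f (a - x))); last exact: tf_subl.
by under eq_Rintegral do rewrite opprK addrC; exact: tf_integral_shift.
Qed.

Lemma tf_indic (a b : R) : test_fun \1_`[a, b].
Proof.
split; [split|].
- exact: measurable_indic.
- exists 1 => x; rewrite indicE; case: (_ \in _); rewrite ?normr1 ?normr0//.
- exists (`|a| + `|b|) => x xL; rewrite indicE memNset//= in_itv/=.
  apply/negP; apply: contraL xL => /andP[ax xb]; rewrite -leNgt.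
  have := ler_norm b; have := ler_norm (- a); have := normr_ge0 a; have := normr_ge0 b.
  by rewrite normrN ler_norml => ? ? ? ?; apply/andP; split; lra.
Qed.

Lemma integral_indic_segment (a b : R) : a <= b -> (\int[mu]_x \1_`[a, b] x = b - a)%R.
Proof.
move=> ab; rewrite /Rintegral integral_indic//= setIT lebesgue_measure_itv/= lte_fin.
by move: ab; rewrite le_eqVlt => /predU1P[->|->//]; rewrite ltxx subrr.
Qed.

Lemma tf_integral_ge_segment f (a b d : R) : a <= b -> test_fun f -> (forall x, 0 <= f x) ->
  (forall x, a <= x <= b -> d <= f x) -> d * (b - a) <= (\int[mu]_x f x)%R.
Proof.
move=> ab tf f0 fd; rewrite -(integral_indic_segment _ _ ab) -tf_integralZ; last exact: tf_indic.
apply: le_tf_integral => //; first by apply: tfZ; exact: tf_indic.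
move=> x; rewrite indicE; have [|_] := boolP (_ \in _); last by rewrite mulr0.
by rewrite in_setE /= in_itv /= => /fd; rewrite mulr1.
Qed.

Lemma tf_integral_le_segment f (a b d : R) : a <= b -> test_fun f ->
  (forall x, a <= x <= b -> f x <= d) -> (forall x, ~~ (a <= x <= b) -> f x <= 0) ->
  (\int[mu]_x f x)%R <= d * (b - a).
Proof.
move=> ab tf fd f0; rewrite -(integral_indic_segment _ _ ab) -tf_integralZ; last exact: tf_indic.
apply: le_tf_integral => //; first by apply: tfZ; exact: tf_indic.
move=> x; rewrite indicE; have [|] := boolP (_ \in _);
  rewrite ?notin_setE ?in_setE /= in_itv /=.
- by rewrite mulr1 => /fd.
- by rewrite mulr0 => /negP/f0.
Qed.

Lemma integrable_on_square (G : R * R -> R) (M B : R) :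
  measurable_fun setT (G : measurableTypeR R * measurableTypeR R -> measurableTypeR R) ->
  (forall z, `|G z| <= M) ->
  (forall x y, B < `|x| \/ B < `|y| -> G (x, y) = 0) ->
  (mu \x mu)%E.-integrable setT (EFin \o G).
Proof.
move=> mG GM GB.
pose mm := (mu \x mu)%E.
pose I : set R := `[- B, B]%classic.
have box : (mm (I `*` I) < +oo)%E.
  have -> : mm (I `*` I) = (mu I * mu I)%E by apply: product_measure1E; exact: measurable_itv.
  have /fineK <- : mu I \is a fin_num by rewrite /I/= lebesgue_measure_itv/=; case: ifP.
  by rewrite -EFinM ltry.
apply: (bounded_support_integrable _ _ mm (I `*` I) M) => //.
  by apply: measurableX; exact: measurable_itv.
move=> [x y]; rewrite /I /= !in_itv /= -!ler_norml => nb.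
apply: GB; apply: contrapT => /not_orP[/negP + /negP].
by rewrite -!leNgt => xB yB; exact: nb.
Qed.

(** Fubini, followed by exchanging the names of the two variables. *)
Lemma double_integral_transpose (G : R * R -> R) (M B : R) :
  measurable_fun setT (G : measurableTypeR R * measurableTypeR R -> measurableTypeR R) ->
  (forall z, `|G z| <= M) ->
  (forall x y, B < `|x| \/ B < `|y| -> G (x, y) = 0) ->
  [/\ mu.-integrable setT (EFin \o (fun x => \int[mu]_y G (x, y))%R),
      mu.-integrable setT (EFin \o (fun x => \int[mu]_y G (y, x))%R) &
      (\int[mu]_x \int[mu]_y G (x, y) = \int[mu]_x \int[mu]_y G (y, x))%R].
Proof.
move=> mG GM GB.
have iG := integrable_on_square _ _ _ mG GM GB.
have iG' : (mu \x mu)%E.-integrable setT (EFin \o (fun z : R * R => G (z.2, z.1))).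
  apply: (integrable_on_square _ M B).
  - by apply: (measurableT_comp mG); exact: measurable_swap.
  - by move=> z; exact: GM.
  - by move=> x y xy; apply: GB; case: xy; [right|left].
have sec1 x : mu.-integrable setT (fun y => (G (x, y))%:E).
  apply: tf_integrable; split; [split|].
  - apply: (measurableT_comp mG); exact: pair1_measurable.
  - by exists M.
  - by exists B => y yB; rewrite GB//; right.
have sec2 x : mu.-integrable setT (fun y => (G (y, x))%:E).
  apply: tf_integrable; split; [split|].
  - apply: (measurableT_comp mG); exact: pair2_measurable.
  - by exists M.
  - by exists B => y yB; rewrite GB//; left.
have E1 : (EFin \o (fun x => \int[mu]_y G (x, y))%R) = fubini_F mu (EFin \o G).
  by apply/funext => x; rewrite /fubini_F/= /Rintegral fineK//; exact: integrable_fin_num (sec1 x).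
have E2 : (EFin \o (fun x => \int[mu]_y G (y, x))%R) = fubini_G mu (EFin \o G).
  by apply/funext => x; rewrite /fubini_G/= /Rintegral fineK//; exact: integrable_fin_num (sec2 x).
split.
- by rewrite E1; exact: integrable_fubini_F.
- by rewrite E2; exact: (integrable_fubini_F iG').
- rewrite {1 3}/Rintegral; congr fine.
  transitivity (\int[mu]_x (fubini_F mu (EFin \o G) x))%E.
    by apply: eq_integral => x _; rewrite -E1.
  rewrite /fubini_F Fubini//.
  by apply: eq_integral => x _; rewrite -[LHS]/(fubini_G mu (EFin \o G) x) -E2.
Qed.

Lemma subr_exchange (a b x y : R) : (a - b) - (x - y) = (a - x) - (b - y).
Proof. by ring. Qed.

(** If d takes the value delta in absolute value at x0, then it stays above
    delta / 2 on an interval of length delta / (L + 1): for Lipschitz functions,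
    smallness in L2 gives smallness in the supremum norm. *)
Lemma lipschitz_square_integral (d : R -> R) (L x0 : R) : 0 <= L ->
  (forall x y, `|d x - d y| <= L * `|x - y|) -> test_fun (fun x => d x ^+ 2) ->
  `|d x0| ^+ 3 <= 4 * (L + 1) * (\int[mu]_x (d x ^+ 2))%R.
Proof.
move=> L0 dL td; set delta := `|d x0|.
have delta0 : 0 <= delta by exact: normr_ge0.
have L1 : 0 < L + 1 by rewrite ltr_wpDl.
(* Here L + 1 replaces L, which may vanish. *)
pose r := delta / (2 * (L + 1)).
have r0 : 0 <= r by rewrite divr_ge0// mulr_ge0// ltW.
have rE : (L + 1) * r = delta / 2 by rewrite /r; field; rewrite lt0r_neq0.
have H : (delta / 2) ^+ 2 * ((x0 + r) - (x0 - r)) <= (\int[mu]_x (d x ^+ 2))%R.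
  apply: tf_integral_ge_segment => //; [lra|by move=> x; exact: sqr_ge0|].
  move=> x xr; rewrite -(real_normK (num_real (d x))).
  have xx0 : `|x0 - x| <= r by rewrite ler_norml; lra.
  apply: lerXn2r; rewrite ?nnegrE//; first by rewrite divr_ge0.
  have := dL x0 x; have : L * `|x0 - x| <= L * r by rewrite ler_wpM2l.
  have := lerB_dist (d x0) (d x); rewrite -/delta; lra.
rewrite -(ler_pM2l (_ : 0 < 4 * (L + 1))) in H; last by rewrite mulr_gt0.
apply: le_trans H.
have -> : 4 * (L + 1) * ((delta / 2) ^+ 2 * (x0 + r - (x0 - r))) =
   2 * delta ^+ 2 * ((L + 1) * r) by field.
by rewrite rE le_eqVlt; apply/orP; left; apply/eqP; field.
Qed.

Lemma far_same_side (L A x y : R) : `|x - y| <= A ->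
  `|L| + A < `|x| \/ `|L| + A < `|y| -> (L < x /\ L < y) \/ (x < - L /\ y < - L).
Proof.
move=> /ler_normlP[h1 h2]; have := ler_norm L; set B := `|L| => hL H.
have [x0|x0] := ltP (B + A) `|x|.
  by move: x0; case: (ger0P x) => ? ?; [left|right]; split; lra.
case: H => [|y0]; first by rewrite ltNge x0.
by move: y0; case: (ger0P y) => ? ?; [left|right]; split; lra.
Qed.

End integration.

(** * Entropy inequalities and the coexisting densities *)

Section two_phase.
Context {R : realType}.

Lemma expR_sub_le (a b : R) : expR a - expR b <= expR a * (a - b).
Proof.
have := expR_ge1Dx (b - a); rewrite expRD expRN => H.
have := ler_wpM2l (ltW (expR_gt0 a)) H.
rewrite mulrCA divff ?gt_eqF ?expR_gt0// mulr1; lra.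
Qed.

(** The right-hand side is the amount by which t ln t - (1 + ln s) t exceeds its
    minimum, attained at t = s. With s = b^2 and t = a^2 the bound is
    ln (b / a) <= b / a - 1, multiplied by 2 a^2. *)
Lemma entropy_gap (s t : R) : 0 < s -> 0 < t ->
  (Num.sqrt t - Num.sqrt s) ^+ 2 <= t * ln t - t * ln s - t + s.
Proof.
move=> s0 t0; set a := Num.sqrt t; set b := Num.sqrt s.
have a0 : 0 < a by rewrite sqrtr_gt0.
have b0 : 0 < b by rewrite sqrtr_gt0.
have -> : t = a ^+ 2 by rewrite sqr_sqrtr// ltW.
have -> : s = b ^+ 2 by rewrite sqr_sqrtr// ltW.
rewrite !lnXn//.
have : 1 + (ln b - ln a) <= expR (ln b - ln a) by exact: expR_ge1Dx.
rewrite expRD expRN !lnK ?posrE// => H.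
have := ler_wpM2l (ltW (mulr_gt0 a0 a0)) H.
have -> : a * a * (b / a) = a * b by field; exact: lt0r_neq0.
lra.
Qed.

(** Follows from t - s = (sqrt t - sqrt s)(sqrt t + sqrt s), where the second
    factor is at most 2 sqrt M. *)
Lemma entropy_gap_quadratic (s t M : R) : 0 < s -> 0 < t -> s <= M -> t <= M ->
  (t - s) ^+ 2 <= 4 * M * (t * ln t - t * ln s - t + s).
Proof.
move=> s0 t0 sM tM; have M0 : 0 < M by exact: lt_le_trans sM.
apply: le_trans (ler_wpM2l _ (entropy_gap _ _ s0 t0)); last by lra.
set a := Num.sqrt t; set b := Num.sqrt s.
have a0 : 0 <= a by exact: sqrtr_ge0.
have b0 : 0 <= b by exact: sqrtr_ge0.
have ta : t = a ^+ 2 by rewrite sqr_sqrtr// ltW.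
have sb : s = b ^+ 2 by rewrite sqr_sqrtr// ltW.
have -> : (t - s) ^+ 2 = (a + b) ^+ 2 * (a - b) ^+ 2 by rewrite ta sb; ring.
apply: ler_wpM2r; first exact: sqr_ge0.
have := sqr_ge0 (a - b); nra.
Qed.

Lemma entropy_min_unique (s t : R) : 0 < s -> 0 < t ->
  t * ln t - t * ln s - t + s <= 0 -> t = s.
Proof.
move=> s0 t0 H; have := entropy_gap_quadratic _ _ (Num.max s t) s0 t0.
rewrite !le_max !lexx orbT => /(_ erefl erefl) G.
have M0 : 0 < Num.max s t by rewrite lt_max s0.
have : (t - s) ^+ 2 <= 0 by apply: (le_trans G); nra.
by rewrite le_eqVlt ltNge sqr_ge0 orbF sqrf_eq0 subr_eq0 => /eqP.
Qed.

Lemma sinh_gt (d : R) : 0 < d -> 2 * d < expR d - expR (- d).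
Proof.
move=> d0; pose F (x : R) := expR x - expR (- x) - 2 * x.
have dF (x : R) : is_derive x 1 F (expR x + expR (- x) - 2).
  apply: is_derive_eq; rewrite /GRing.scale/=; ring.
have cF : {within `[0, d], continuous F}.
  apply: continuous_subspaceT => x; apply: differentiable_continuous.
  by apply/derivable1_diffP; apply: ex_derive.
have [e e0d] := MVT d0 (fun x _ => dF x) cF.
rewrite /F oppr0 subrr mulr0 !subr0 => H.
move: e0d; rewrite in_itv/= => /andP[e0 ed].
suff : 0 < (expR e + expR (- e) - 2) * d by move: H; rewrite addr0; lra.
apply: mulr_gt0 => //.
have e2 : expR e * expR (- e) = 1 by rewrite expRxMexpNx_1.
have : 1 < expR e by rewrite expR_gt1.
have := expR_gt0 (- e); nra.
Qed.

(** The hypothesis says that 1 / a is the logarithmic mean of s and t. In terms of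
    d = ln (t / s) / 2 the claim is d / sinh d < 1. *)
Lemma log_mean_gt_geometric_mean (s t a : R) : 0 < s -> s < t ->
  a * (t - s) = ln t - ln s -> a ^+ 2 * s * t < 1.
Proof.
move=> s0 st E; have t0 : 0 < t by exact: lt_trans st.
pose u := Num.sqrt t; pose v := Num.sqrt s.
have u0 : 0 < u by rewrite sqrtr_gt0.
have v0 : 0 < v by rewrite sqrtr_gt0.
have tu : t = u ^+ 2 by rewrite sqr_sqrtr// ltW.
have sv : s = v ^+ 2 by rewrite sqr_sqrtr// ltW.
have vu : v < u by rewrite ltr_sqrt.
have d0 : 0 < ln u - ln v by rewrite subr_gt0 ltr_ln ?posrE.
have := sinh_gt _ d0; rewrite opprB !expRD !expRN !lnK ?posrE// => H.
have Ea : a * (u ^+ 2 - v ^+ 2) = 2 * (ln u - ln v).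
  by move: E; rewrite tu sv !lnXn// => ->; ring.
have uv0 : 0 < u * v by exact: mulr_gt0.
have K : a * (u ^+ 2 - v ^+ 2) * (u * v) < u ^+ 2 - v ^+ 2.
  rewrite Ea; have -> : u ^+ 2 - v ^+ 2 = (u / v - v / u) * (u * v).
    by field; rewrite !lt0r_neq0.
  by rewrite ltr_pM2r.
have w0 : 0 < u ^+ 2 - v ^+ 2 by nra.
have a0 : 0 < a by have : 0 < a * (u ^+ 2 - v ^+ 2) by [rewrite Ea; lra]; rewrite pmulr_lgt0.
have auv : a * (u * v) < 1.
  by rewrite -(ltr_pM2r w0) mul1r mulrAC.
have auv0 : 0 < a * (u * v) by exact: mulr_gt0.
have -> : a ^+ 2 * s * t = (a * (u * v)) ^+ 2 by rewrite tu sv; ring.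
by rewrite expr2; nra.
Qed.

(** Each density minimizes a function of the form t ln t + b t on [0, +oo[, whose
    only minimizer is exp(- 1 - b); this excludes the density 0 and gives the two
    equations. Their difference identifies alpha as the inverse of the logarithmic
    mean of the two densities, whence the last two claims. *)
Lemma two_phase_euler_lagrange (J : R -> R) (nu : nat) (kappa beta rhom rhop : R) :
  two_phase_densities J nu kappa beta rhom rhop ->
  let alpha := beta * Jhat J nu in
  [/\ 0 < rhom < rhop,
      ln rhop + alpha * rhom = kappa - 1,
      ln rhom + alpha * rhop = kappa - 1,
      0 < alpha & alpha ^+ 2 * rhom * rhop < 1].
Proof.
move=> [rr H] alpha.
have [/= p0 m0 mn] : minimizer J nu kappa beta (rhop, rhom) by apply/H; left.
have EL (s t : R) : 0 <= s -> 0 <= t ->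
   (forall t', 0 <= t' -> t * ln t + (alpha * s - kappa) * t
     <= t' * ln t' + (alpha * s - kappa) * t') ->
   0 < t /\ ln t + alpha * s = kappa - 1.
  move=> s0 t0 Ht.
  have tp : 0 < t.
    rewrite lt_neqAle t0 andbT; apply/eqP => t0'.
    have := Ht _ (expR_ge0 (kappa - alpha * s - 1)).
    rewrite -t0' mul0r mulr0 addr0 expRK.
    have := expR_gt0 (kappa - alpha * s - 1); nra.
  split=> //; have := Ht _ (expR_ge0 (kappa - alpha * s - 1)).
  set e := expR _ => He; have e0 : 0 < e by exact: expR_gt0.
  have le : ln e = kappa - alpha * s - 1 by rewrite /e expRK.
  have -> : t = e.
    by apply: entropy_min_unique => //; move: He; rewrite le; nra.
  by rewrite le; ring.
have [mp E2] : 0 < rhom /\ ln rhom + alpha * rhop = kappa - 1.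
  apply: EL => // t t0; have := mn rhop t p0 t0.
  by rewrite /free_energy -/alpha; lra.
have [pp E1] : 0 < rhop /\ ln rhop + alpha * rhom = kappa - 1.
  apply: EL => // t t0; have := mn t rhom t0 m0.
  by rewrite /free_energy -/alpha; lra.
have E : alpha * (rhop - rhom) = ln rhop - ln rhom by lra.
split=> //.
- by rewrite mp.
- have : 0 < alpha * (rhop - rhom) by rewrite E subr_gt0 ltr_ln ?posrE.
  by rewrite pmulr_lgt0// subr_gt0.
- exact: log_mean_gt_geometric_mean E.
Qed.

End two_phase.

(** * Limits of equi-Lipschitz families and limits at infinity *)

Section compactness.
Context {R : realType}.

(** A cluster point of an ultrafilter is its limit, since for each neighbourhood
    either it or its complement belongs to the ultrafilter. *)
Lemma ultrafilter_limit (U : set_system nat) (s : nat -> R) (a b : R) :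
  UltraFilter U -> (forall k, a <= s k <= b) ->
  exists p : R, forall e : R, 0 < e -> U [set k | `|s k - p| < e].
Proof.
move=> UU sab.
have := @segment_compact R a b (s @ U) _.
have sU : (s @ U) `[a, b]%classic.
  apply: (@filterS _ U _ setT); last exact: filterT.
  by move=> k _; rewrite /= in_itv/=; exact: sab.
move=> /(_ _ sU)[p [_ cp]]; exists p => e e0.
have [//|UC] := in_ultra_setVsetC [set k | `|s k - p| < e] UU.
have sC : (s @ U) (~` (ball p e)).
  apply: (@filterS _ U _ (~` [set k | `|s k - p| < e]) _ _ UC) => k /= nk pk.
  by apply: nk; move: pk; rewrite /ball/= distrC.
have [z [zC zb]] := cp _ _ sC (nbhsx_ballx p e e0).
by exfalso.
Qed.

(** A form of the Arzela-Ascoli theorem that avoids subsequences: the pointwise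
    limit n along an ultrafilter is again Lipschitz, and closeness of N k to n at
    the points of a finite grid implies closeness on the interval. *)
Lemma locally_uniform_limit_point (N : nat -> R -> R) (a b L : R) :
  (forall k x, a <= N k x <= b) -> 0 <= L ->
  (forall k x y, `|N k x - N k y| <= L * `|x - y|) ->
  exists n : R -> R, forall (X e : R) (k0 : nat), 0 < e ->
    exists k, (k0 <= k)%N /\ forall x, `|x| <= X -> `|N k x - n x| < e.
Proof.
move=> Nab L0 NL.
have [U [UU ooU]] := @ultraFilterLemma nat \oo _.
have lim x : exists p : R, forall e : R, 0 < e -> U [set k | `|N k x - p| < e].
  exact: ultrafilter_limit.
have [n nP] := choice lim; exists n => X e k0 e0.
have nL x y : `|n x - n y| <= L * `|x - y|.
  rewrite leNgt; apply/negP => gap.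
  pose d := (`|n x - n y| - L * `|x - y|) / 2.
  have d0 : 0 < d by rewrite divr_gt0// subr_gt0.
  have [k [/= kx ky]] := filter_ex (filterI (nP x _ d0) (nP y _ d0)).
  have := NL k x y.
  have : `|n x - n y| <= `|N k x - n x| + `|N k x - N k y| + `|N k y - n y|.
    have -> : n x - n y = - (N k x - n x) + (N k x - N k y) + (N k y - n y) by ring.
    by rewrite (le_trans (ler_normD _ _))// lerD2r (le_trans (ler_normD _ _))// normrN.
  rewrite /d in kx ky; lra.
(* The mesh: moving by h changes N k and n by at most e / 4. *)
pose h := e / (4 * (L + 1)).
have h0 : 0 < h by rewrite divr_gt0// mulr_gt0// ltr_wpDl.
have Lh : L * h <= e / 4.
  have -> : e / 4 = (L + 1) * h by rewrite /h; field; rewrite lt0r_neq0// ltr_wpDl.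
  by apply: ler_wpM2r; [exact: ltW|lra].
pose Q := Num.truncn (2 * X / h).
pose z (i : 'I_Q.+1) := - X + i%:R * h.
have e4 : 0 < e / 4 by rewrite divr_gt0.
have Ugrid : U [set k | forall i : 'I_Q.+1, `|N k (z i) - n (z i)| < e / 4].
  by apply: filter_forall => i; exact: nP.
have Uk0 : U [set k | (k0 <= k)%N] by apply: ooU; exact: nbhs_infty_ge.
have [k [/= kg kk0]] := filter_ex (filterI Ugrid Uk0).
exists k; split=> // x xX.
have /ler_normlP[x1 x2] := xX.
have q0 : 0 <= (x + X) / h by rewrite divr_ge0 ?(ltW h0)//; lra.
have iQ : (Num.truncn ((x + X) / h) < Q.+1)%N.
  rewrite ltnS; apply: Num.Theory.le_truncn; rewrite ler_pM2r ?invr_gt0//; lra.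
pose i := Ordinal iQ.
have xz : `|x - z i| <= h.
  have /andP[t1 t2] := Num.Theory.truncn_itv q0.
  rewrite ler_pdivlMr// in t1; rewrite ltr_pdivrMr// -natr1 in t2.
  rewrite /z /= ger0_norm; lra.
have := kg i; have := NL k x (z i); have := nL (z i) x.
rewrite (distrC (z i) x) => b1 b2 b3.
have c1 : L * `|x - z i| <= L * h by rewrite ler_wpM2l.
have : `|N k x - n x| <= `|N k x - N k (z i)| + `|N k (z i) - n (z i)| + `|n (z i) - n x|.
  have -> : N k x - n x = (N k x - N k (z i)) + (N k (z i) - n (z i)) + (n (z i) - n x) by ring.
  by rewrite (le_trans (ler_normD _ _))// lerD2r (le_trans (ler_normD _ _)).
lra.
Qed.

End compactness.

Section limits_at_infinity.
Context {R : realType}.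

Lemma cvg_pinftyP (f : R -> R) (l : R) : f @ +oo --> l <->
  forall e : R, 0 < e -> exists X : R, forall x : R, X < x -> `|l - f x| < e.
Proof.
split=> [/cvgrPdist_lt H e e0|H]; first by have [X [_ HX]] := H e e0; exists X.
apply/cvgrPdist_lt => e e0; have [X HX] := H e e0.
by exists X; split; [exact: num_real|].
Qed.

Lemma cvg_ninftyP (f : R -> R) (l : R) : f @ -oo --> l <->
  forall e : R, 0 < e -> exists X : R, forall x : R, x < X -> `|l - f x| < e.
Proof.
split=> [/cvgrPdist_lt H e e0|H]; first by have [X [_ HX]] := H e e0; exists X.
apply/cvgrPdist_lt => e e0; have [X HX] := H e e0.
by exists X; split; [exact: num_real|].
Qed.

Section profiles.
Variables (f : R -> R) (a b : R).

Lemma nondecreasing_profile_bounds : nondecreasing_fun f ->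
  f @ -oo --> a -> f @ +oo --> b -> forall x, a <= f x <= b.
Proof.
move=> nd /cvg_ninftyP la /cvg_pinftyP lb x; apply/andP; split; rewrite leNgt; apply/negP => H.
- have [X HX] := la (a - f x) ltac:(lra).
  pose y := Num.min (X - 1) x.
  have yX : y < X by rewrite gt_min; apply/orP; left; lra.
  have yx : y <= x by rewrite ge_min lexx orbT.
  by have := HX y yX; have := nd _ _ yx; rewrite ltr_norml => ? /andP[? ?]; lra.
- have [X HX] := lb (f x - b) ltac:(lra).
  pose y := Num.max (X + 1) x.
  have yX : X < y by rewrite lt_max; apply/orP; left; lra.
  have yx : x <= y by rewrite le_max lexx orbT.
  by have := HX y yX; have := nd _ _ yx; rewrite ltr_norml => ? /andP[? ?]; lra.
Qed.

Lemma nondecreasing_cvg_pinfty : nondecreasing_fun f -> (forall x, f x <= b) ->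
  (forall e : R, 0 < e -> exists X, b - e < f X) -> f @ +oo --> b.
Proof.
move=> nd fb fe; apply/cvg_pinftyP => e e0; have [X HX] := fe e e0; exists X => x xX.
have := fb x; have := nd _ _ (ltW xX) => h1 h2.
by rewrite ger0_norm; lra.
Qed.

Lemma nondecreasing_cvg_ninfty : nondecreasing_fun f -> (forall x, a <= f x) ->
  (forall e : R, 0 < e -> exists X, f X < a + e) -> f @ -oo --> a.
Proof.
move=> nd fb fe; apply/cvg_ninftyP => e e0; have [X HX] := fe e e0; exists X => x xX.
have := fb x; have := nd _ _ (ltW xX) => h1 h2.
by rewrite ler0_norm; lra.
Qed.

End profiles.

Lemma cvg_ninfty_opp (f : R -> R) (a : R) : f @ -oo --> a <-> (fun x => f (- x)) @ +oo --> a.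
Proof.
split=> [/cvg_ninftyP H|/cvg_pinftyP H]; [apply/cvg_pinftyP|apply/cvg_ninftyP] => e /H[X HX];
  exists (- X) => x xX.
- by apply: HX; rewrite ltrNl.
- by have := HX (- x); rewrite opprK; apply; rewrite ltrNr.
Qed.

Lemma cvg_pinfty_opp (f : R -> R) (a : R) : f @ +oo --> a <-> (fun x => f (- x)) @ -oo --> a.
Proof.
split=> [/cvg_pinftyP H|/cvg_ninftyP H]; [apply/cvg_ninftyP|apply/cvg_pinftyP] => e /H[X HX];
  exists (- X) => x xX.
- by apply: HX; rewrite ltrNr.
- by have := HX (- x); rewrite opprK; apply; rewrite ltrNl.
Qed.

Lemma lipschitz_continuous (f : R -> R) (L : R) :
  (forall x y, `|f x - f y| <= L * `|x - y|) -> continuous f.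
Proof.
move=> fL x; apply/cvgrPdist_lt => e e0; near=> y.
apply: le_lt_trans (fL x y) _.
apply: (@le_lt_trans _ _ ((`|L| + 1) * `|x - y|)).
  by apply: ler_wpM2r => //; have := ler_norm L; lra.
rewrite mulrC -ltr_pdivlMr ?ltr_wpDl//.
near: y; apply/nbhs_ballP; exists (e / (`|L| + 1)) => /=; last by [].
by rewrite divr_gt0// ltr_wpDl.
Unshelve. all: by end_near.
Qed.

End limits_at_infinity.

Section fronts.
Context {R : realType}.
Notation mu := (@lebesgue_measure R).

(** * Convolution with an even unimodal kernel *)

Definition unimodal_kernel (K : R -> R) : Prop :=
  [/\ test_fun K, forall s : R, 0 <= K s, forall s : R, K (- s) = K s &
      forall s t : R, 0 <= s -> s <= t -> K t <= K s].

Variable K : R -> R.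
Hypothesis uK : unimodal_kernel K.
Notation mass := (\int[mu]_s K s)%R.

Section kernel_facts.
Let tfK : test_fun K. Proof. by case: uK. Qed.
Let K_ge0 s : 0 <= K s. Proof. by case: uK. Qed.
Let K_even s : K (- s) = K s. Proof. by case: uK. Qed.
Let K_decr (s t : R) : 0 <= s -> s <= t -> K t <= K s. Proof. by case: uK => _ _ _; exact. Qed.

Lemma kernel_abs s : K `|s| = K s.
Proof. by case: (ger0P s) => // _; rewrite K_even. Qed.

Lemma kernel_le_peak s : K s <= K 0.
Proof. by rewrite -kernel_abs K_decr. Qed.

Lemma kernel_support : exists A : R, 0 < A /\ forall s : R, A < `|s| -> K s = 0.
Proof.
have [_ [L KL]] := tfK; exists (`|L| + 1); split; first by rewrite ltr_wpDl.
move=> s sL; apply: KL; have := ler_norm L; lra.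
Qed.

Lemma tf_conv_integrand (h : R -> R) x : bounded_measurable h ->
  test_fun (fun y => K (x - y) * h y).
Proof. by move=> bh; apply: tfM => //; exact: tf_subl. Qed.

Lemma tf_conv_integrand_swap (h : R -> R) x : bounded_measurable h ->
  test_fun (fun y => K y * h (x - y)).
Proof. by move=> bh; apply: tfM => //; exact: bm_subl. Qed.

(** Moving the translation from K to h turns monotonicity of h into monotonicity
    of the convolution. *)
Lemma conv_swap (h : R -> R) x : bounded_measurable h ->
  convolution K h x = (\int[mu]_s (K s * h (x - s)))%R.
Proof.
move=> bh; rewrite -(tf_integral_subl _ x); last exact: tf_conv_integrand_swap.
by apply: eq_Rintegral => y _; rewrite subKr.
Qed.

Lemma conv_shift (h : R -> R) a x : bounded_measurable h ->
  convolution K (fun y => h (y + a)) x = convolution K h (x + a).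
Proof.
move=> bh; rewrite !conv_swap//; last exact: bm_shift.
by apply: eq_Rintegral => y _; rewrite addrAC.
Qed.

Lemma conv_opp (h : R -> R) x : bounded_measurable h ->
  convolution K (fun y => h (- y)) x = convolution K h (- x).
Proof.
move=> bh; rewrite conv_swap//; last exact: bm_opp.
rewrite conv_swap// -(tf_integral_opp (fun s => K s * h (- x - s))); last first.
  exact: tf_conv_integrand_swap.
by apply: eq_Rintegral => y _; rewrite K_even opprB opprK addrC.
Qed.

Lemma conv_cst c x : convolution K (fun=> c) x = mass * c.
Proof.
rewrite conv_swap; last exact: bm_cst.
by rewrite mulrC -tf_integralZ//; apply: eq_Rintegral => y _; rewrite mulrC.
Qed.

Lemma convB (g h : R -> R) x : bounded_measurable g -> bounded_measurable h ->
  convolution K (fun y => g y - h y) x = convolution K g x - convolution K h x.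
Proof.
move=> bg bh; rewrite /convolution -tf_integralB; [|exact: tf_conv_integrand..].
by apply: eq_Rintegral => y _; rewrite mulrBr.
Qed.

Lemma convN (h : R -> R) x : bounded_measurable h ->
  convolution K (fun y => - h y) x = - convolution K h x.
Proof.
move=> bh; rewrite -[LHS](_ : convolution K (fun y => 0 - h y) x = _); last first.
  by congr convolution; apply/funext => y; rewrite sub0r.
by rewrite convB//; [rewrite conv_cst mulr0 sub0r|exact: bm_cst].
Qed.

Lemma conv_local (A : R) (g h : R -> R) x : (forall s : R, A < `|s| -> K s = 0) ->
  bounded_measurable g -> bounded_measurable h ->
  (forall y, `|x - y| <= A -> g y <= h y) -> convolution K g x <= convolution K h x.
Proof.
move=> KA bg bh gh; apply: le_tf_integral => [||y]; [exact: tf_conv_integrand..|].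
have [/gh|/KA ->] := leP `|x - y| A; last by rewrite !mul0r.
by move=> ghy; rewrite ler_wpM2l.
Qed.

Lemma conv_le (g h : R -> R) x : bounded_measurable g -> bounded_measurable h ->
  (forall y, g y <= h y) -> convolution K g x <= convolution K h x.
Proof. by have [A [_ KA]] := kernel_support => bg bh gh; apply: (@conv_local A). Qed.

Lemma conv_between (h : R -> R) (a b x : R) : bounded_measurable h ->
  (forall y, a <= h y <= b) -> mass * a <= convolution K h x <= mass * b.
Proof.
move=> bh hab; rewrite -!(conv_cst _ x); apply/andP.
split; apply: conv_le => //; try exact: bm_cst.
  by move=> y; case/andP: (hab y).
by move=> y; case/andP: (hab y).
Qed.

Lemma conv_nondecreasing (h : R -> R) : bounded_measurable h ->
  nondecreasing_fun h -> nondecreasing_fun (convolution K h).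
Proof.
move=> bh ndh x y xy; rewrite !conv_swap//.
apply: le_tf_integral => [||s]; [exact: tf_conv_integrand_swap..|].
by rewrite ler_wpM2l// ndh// lerD2r.
Qed.

Lemma conv_nonincreasing (h : R -> R) : bounded_measurable h ->
  nonincreasing_fun h -> nonincreasing_fun (convolution K h).
Proof.
move=> bh ndh x y xy; rewrite !conv_swap//.
apply: le_tf_integral => [||s]; [exact: tf_conv_integrand_swap..|].
by rewrite ler_wpM2l// ndh// lerD2r.
Qed.

(** The increment is an integral of K against the increment of h, so K may be
    replaced by its maximum K 0 on its support [- A, A]. What remains is the
    difference of the integrals of h - a over two intervals of length 2 A shifted
    by y - x, and it is at most the integral over [x + A, y + A]. *)
Lemma conv_lipschitz_nondecreasing (h : R -> R) (a b x y : R) : nondecreasing_fun h ->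
  (forall t, a <= h t <= b) -> x <= y ->
  convolution K h y - convolution K h x <= K 0 * (b - a) * (y - x).
Proof.
move=> ndh hab xy; have bh : bounded_measurable h by exact: bm_nondecreasing ndh hab.
have [A [A0 KA]] := kernel_support.
rewrite !conv_swap// -tf_integralB; [|exact: tf_conv_integrand_swap..].
pose chi (z t : R) : R := \1_`[- A, A] (z - t).
have chiE (z t : R) : chi z t = (z - A <= t <= z + A)%R%:R.
  rewrite /chi indicE; congr (nat_of_bool _)%:R; apply/idP/idP; rewrite in_setE/= in_itv/=.
    by move=> ?; apply/andP; split; lra.
  by move=> ?; apply/andP; split; lra.
have tchi z : test_fun (chi z) by apply: tf_subl; exact: tf_indic.
have ha : bounded_measurable (fun t => h t - a) by apply: bmB => //; exact: bm_cst.
apply: (@le_trans _ _ (\int[mu]_s (K 0 * (\1_`[- A, A] s * (h (y - s) - a)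
    - \1_`[- A, A] s * (h (x - s) - a))))%R).
  have bhs z : bounded_measurable (fun s => h (z - s) - a) by exact: (bm_subl _ z ha).
  apply: le_tf_integral => [||s].
  - by apply: tfB; exact: tf_conv_integrand_swap.
  - by apply/tfZ/tfB; apply: tfM => //; exact: tf_indic.
  rewrite -!mulrBr !opprB addrA subrK.
  have hs : 0 <= h (y - s) - h (x - s) by rewrite subr_ge0 ndh// lerD2r.
  rewrite indicE; have [|] := boolP (_ \in _); rewrite ?notin_setE ?in_setE /= in_itv/=.
    by move=> _; rewrite mul1r ler_wpM2r// kernel_le_peak.
  by rewrite -ler_norml => /negP; rewrite -ltNge => /KA ->; rewrite !mul0r mulr0.
have tt z : test_fun (fun s => \1_`[- A, A] s * (h (z - s) - a)).
  by apply: tfM; [exact: tf_indic|exact: (bm_subl _ z ha)].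
rewrite tf_integralZ; last exact: tfB.
rewrite -mulrA ler_wpM2l// tf_integralB//.
have E z : (\int[mu]_s (\1_`[- A, A] s * (h (z - s) - a)))%R
         = (\int[mu]_s (chi z s * (h s - a)))%R.
  rewrite -(tf_integral_subl _ z)//; apply: eq_Rintegral => s _.
  by rewrite /chi subKr.
rewrite !E -tf_integralB; [|by apply: tfM..].
rewrite (_ : y - x = (y + A) - (x + A)); last by ring.
apply: tf_integral_le_segment => [||t /andP[t1 t2]|t tn].
- by rewrite lerD2r.
- by apply: tfB; apply: tfM.
- rewrite !chiE; have /andP[h1 h2] := hab t.
  by case: (_ <= _ <= _); case: (_ <= _ <= _); rewrite ?mul1r ?mul0r; lra.
- rewrite !chiE; have /andP[h1 h2] := hab t.
  case: (boolP (y - A <= t <= y + A)) => [/andP[ty1 ty2]|_].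
    have -> : (x - A <= t <= x + A).
      by apply/andP; split; move: tn; rewrite negb_and -!ltNge => /orP[]; lra.
    by rewrite subrr.
  by rewrite mul0r sub0r oppr_le0 mulr_ge0// subr_ge0.
Qed.

Lemma conv_lipschitz (h : R -> R) (a b x y : R) :
  nondecreasing_fun h \/ nonincreasing_fun h ->
  (forall t, a <= h t <= b) ->
  `|convolution K h x - convolution K h y| <= K 0 * (b - a) * `|x - y|.
Proof.
move=> mh hab; wlog ndh : h a b hab mh / nondecreasing_fun h.
  move=> W; case: mh => [ndh|nih]; first by apply: W => //; left.
  have ndN : nondecreasing_fun (fun t => - h t) by move=> s t st; rewrite lerN2 nih.
  have := W (fun t => - h t) (- b) (- a) _ (or_introl ndN) ndN.
  rewrite !convN; [|exact: bm_nonincreasing nih hab..].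
  rewrite -opprD normrN addrC (_ : - a - - b = b - a); last by ring.
  by apply=> t; rewrite !lerN2 andbC.
wlog xy : x y / y <= x.
  move=> W; case: (leP y x) => [/W//|/ltW/W].
  by rewrite distrC [`|y - x|]distrC.
have bh := bm_nondecreasing _ _ _ ndh hab.
rewrite ger0_norm; last by rewrite subr_ge0 conv_nondecreasing.
by rewrite ger0_norm ?subr_ge0//; exact: conv_lipschitz_nondecreasing.
Qed.

Lemma kernel_pos_radius : 0 < mass -> exists r : R, 0 < r /\ 0 < K r.
Proof.
move=> m0; apply: contrapT => nr.
have Kz (s : R) : 0 < s -> K s = 0.
  move=> s0; apply/eqP; rewrite eq_le K_ge0 andbT leNgt; apply/negP => Ks.
  by apply: nr; exists s.
suff : mass <= K 0 * (0 - 0) by rewrite subrr mulr0 leNgt m0.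
apply: tf_integral_le_segment => // [s _|s]; first exact: kernel_le_peak.
rewrite -eq_le eq_sym => s0.
by rewrite -kernel_abs Kz// normr_gt0.
Qed.

(** The integrand K(x - y) D(y) has constant sign and its integral vanishes;
    wherever K(x - y) > 0, continuity then forces D y = 0. *)
Lemma conv_eq0_near (D : R -> R) (x r : R) : 0 < r -> 0 < K r -> bounded_measurable D ->
  continuous D -> (forall y, D y <= 0) -> convolution K D x = 0 ->
  forall y, `|x - y| < r -> D y = 0.
Proof.
move=> r0 Kr bD cD D0 convD y xyr; apply/eqP; rewrite eq_le D0/= leNgt; apply/negP => Dy.
have : \forall z \near y, D z < D y / 2.
  have e0 : 0 < - (D y / 2) by lra.
  move/cvgrPdist_lt: (cD y) => /(_ _ e0); apply: filterS => z.
  by rewrite ltr_norml => /andP[]; lra.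
move/nbhs_ballP => [e /= e0 be].
pose d := Num.min (e / 2) ((r - `|x - y|) / 2).
have d0 : 0 < d by rewrite lt_min; apply/andP; split; lra.
have [de dr] : d <= e / 2 /\ d <= (r - `|x - y|) / 2.
  by rewrite /d !ge_min !lexx orbT.
have Pos : 0 < K r * - (D y / 2) * (y + d - (y - d)).
  by apply: mulr_gt0; [apply: mulr_gt0|]; lra.
have I0 : (\int[mu]_z (K (x - z) * - D z))%R = 0.
  by have := convN D x bD; rewrite convD oppr0.
suff : K r * - (D y / 2) * (y + d - (y - d)) <= (\int[mu]_z (K (x - z) * - D z))%R.
  by rewrite I0 leNgt Pos.
apply: tf_integral_ge_segment; first lra.
- by apply: tf_conv_integrand; exact: bmN.
- by move=> z; rewrite mulr_ge0// oppr_ge0.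
- move=> z /andP[z1 z2]; have yz : `|y - z| <= d by rewrite ler_norml; apply/andP; split; lra.
  apply: ler_pM; [exact: ltW|lra| |].
    rewrite -[K (x - z)]kernel_abs K_decr//.
    have := ler_normD (x - y) (y - z); rewrite addrA subrK; lra.
  by rewrite lerN2 ltW//; apply: be; rewrite /ball/=; lra.
Qed.

End kernel_facts.

(** * The interaction energy of two profiles *)

Definition eventually_constant (n : R -> R) : Prop :=
  exists L : R, forall x y, (L < x /\ L < y) \/ (x < - L /\ y < - L) -> n x = n y.

(** The nonlocal part of the energy: what the convolution adds to the local
    product mass * m * n. *)
Definition interaction (m n : R -> R) : R :=
  (\int[mu]_x (m x * (convolution K n x - mass * n x)))%R.

(** Write the interaction as the double integral of
    G(x, y) = K(x - y) m(x) (n(y) - n(x)). Since n is constant far away and K has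
    bounded support, G vanishes outside a square, so Fubini applies and G may be
    averaged with its transpose. *)
Lemma interaction_symmetrized (m n : R -> R) :
  bounded_measurable m -> bounded_measurable n -> eventually_constant n ->
  2 * interaction m n =
  (\int[mu]_x \int[mu]_y (K (x - y) * ((n y - n x) * (m x - m y))))%R.
Proof.
move=> bm bn [L nL].
have [A [A0 KA]] := kernel_support.
have tK : test_fun K by case: uK.
have [[mK [CK KC]] _] := tK.
have [mm [Cm mC]] := bm; have [mn [Cn nC]] := bn.
pose G (z : R * R) := K (z.1 - z.2) * (m z.1 * (n z.2 - n z.1)).
have mG : measurable_fun setT (G : measurableTypeR R * measurableTypeR R -> measurableTypeR R).
  apply: measurable_funM; [|apply: measurable_funM; [|apply: measurable_funB]].
  - by apply: (measurableT_comp mK); exact: measurable_funB.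
  - exact: (measurableT_comp mm).
  - exact: (measurableT_comp mn).
  - exact: (measurableT_comp mn).
have GM z : `|G z| <= CK * (Cm * (Cn + Cn)).
  rewrite !normrM ler_pM// ler_pM//.
  by apply: le_trans (ler_normB _ _) _; exact: lerD.
have GB x y : `|L| + A < `|x| \/ `|L| + A < `|y| -> G (x, y) = 0.
  move=> H; rewrite /G/=; have [xy|/KA->] := leP `|x - y| A; last by rewrite mul0r.
  suff -> : n y = n x by rewrite subrr !mulr0.
  by case: (far_same_side _ _ _ _ xy H) => h; [apply: nL; left|apply: nL; right]; case: h.
have sec1 x : test_fun (fun y => G (x, y)).
  split; [split|].
  - by apply: (measurableT_comp mG); exact: pair1_measurable.
  - by exists (CK * (Cm * (Cn + Cn))) => y; exact: GM.
  - by exists (`|L| + A) => y yB; apply: GB; right.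
have sec2 x : test_fun (fun y => G (y, x)).
  split; [split|].
  - by apply: (measurableT_comp mG); exact: pair2_measurable.
  - by exists (CK * (Cm * (Cn + Cn))) => y; exact: GM.
  - by exists (`|L| + A) => y yB; apply: GB; left.
have [i1 i2 E] := double_integral_transpose _ _ _ mG GM GB.
have E1 : interaction m n = (\int[mu]_x \int[mu]_y G (x, y))%R.
  apply: eq_Rintegral => x _; rewrite /G/= /convolution.
  have t1 := tf_conv_integrand _ x bn; have t2 := tf_conv_integrand _ x (bm_cst (n x)).
  rewrite -(conv_cst (n x) x) -(tf_integralB _ _ t1 t2) -(tf_integralZ _ _ (tfB _ _ t1 t2)).
  by apply: eq_Rintegral => y _; ring.
have E2 := etrans E1 E.
have -> : 2 * interaction m n = interaction m n + interaction m n by ring.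
rewrite {1}E1 E2 -(RintegralD measurableT i1 i2).
apply: eq_Rintegral => x _; rewrite -(tf_integralD _ _ (sec1 x) (sec2 x)).
have Kev (t : R) : K (- t) = K t by case: uK.
by apply: eq_Rintegral => y _; rewrite /G/= -[K (y - x)]Kev opprB; ring.
Qed.

Lemma interaction_sym (m n : R -> R) :
  bounded_measurable m -> bounded_measurable n ->
  eventually_constant m -> eventually_constant n -> interaction m n = interaction n m.
Proof.
move=> bm bn em en; apply: (@mulfI _ 2) => //.
rewrite (interaction_symmetrized m n bm bn en) (interaction_symmetrized n m bn bm em).
by apply: eq_Rintegral => x _; apply: eq_Rintegral => y _; ring.
Qed.

Lemma interaction_ge0 (m n : R -> R) :
  nonincreasing_fun m -> nondecreasing_fun n ->
  bounded_measurable m -> bounded_measurable n -> eventually_constant n ->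
  0 <= interaction m n.
Proof.
move=> nim ndn bm bn en; rewrite -(@pmulr_rge0 _ 2)// interaction_symmetrized//.
apply: Rintegral_ge0 => x _; apply: Rintegral_ge0 => y _.
apply: mulr_ge0; first by case: uK.
have [/[dup]/nim h1/ndn h2|/ltW/[dup]/nim h1/ndn h2] := leP x y.
  by apply: mulr_ge0; lra.
by apply: mulr_le0; lra.
Qed.

Lemma conv_near_constant (A : R) (n : R -> R) (x : R) :
  (forall s : R, A < `|s| -> K s = 0) -> bounded_measurable n ->
  (forall y, `|x - y| <= A -> n y = n x) -> convolution K n x = mass * n x.
Proof.
move=> KA bn nx; rewrite -(conv_cst (n x) x); have bc := bm_cst (n x).
by apply/eqP; rewrite eq_le; apply/andP; split;
  apply: (conv_local _ _ _ _ KA) => // y /nx ->.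
Qed.

Lemma tf_interaction (m n : R -> R) : bounded_measurable m ->
  nondecreasing_fun n \/ nonincreasing_fun n -> bounded_measurable n ->
  eventually_constant n -> test_fun (fun x => m x * (convolution K n x - mass * n x)).
Proof.
move=> bm mon bn [L nL]; apply: tfMl => //.
have [A [A0 KA]] := kernel_support.
have [_ [M nM]] := bn.
have nMM x : - M <= n x <= M by rewrite -ler_norml.
split.
  apply: bmB; last by apply: bmM => //; exact: bm_cst.
  have cb x := conv_between _ _ _ x bn nMM.
  case: mon => mon; [apply: (bm_nondecreasing _ _ _ _ cb)|apply: (bm_nonincreasing _ _ _ _ cb)].
    exact: conv_nondecreasing.
  exact: conv_nonincreasing.
exists (`|L| + A) => x xL; apply/eqP; rewrite subr_eq0; apply/eqP.
apply: (conv_near_constant A) => // y /ler_normlP[h1 h2].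
apply: nL; have := ler_norm L => hL.
by move: xL; case: (ger0P x) => ? ?; [left|right]; split; lra.
Qed.

(** * The response map and comparison of solutions *)

Variables (beta c rm rp : R).
Notation alpha := (beta * mass).
Hypothesis beta0 : 0 < beta.
Hypothesis rmp : 0 < rm < rp.
Hypothesis ELp : ln rp + alpha * rm = c.
Hypothesis ELm : ln rm + alpha * rp = c.
Hypothesis alpha0 : 0 < alpha.
Hypothesis stable : alpha ^+ 2 * rm * rp < 1.

Let rm0 : 0 < rm. Proof. by case/andP: rmp. Qed.
Let rmrp : rm < rp. Proof. by case/andP: rmp. Qed.
Let rp0 : 0 < rp. Proof. exact: lt_trans rmrp. Qed.
Let mass0 : 0 < mass. Proof. by have := alpha0; rewrite pmulr_rgt0. Qed.
Let K00 : 0 <= K 0. Proof. by case: uK. Qed.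

(** The map Phi of the introduction: for a given profile h of one species, the
    equilibrium density of the other one. *)
Definition response (h : R -> R) (x : R) : R := expR (c - beta * convolution K h x).

Lemma response_cst (a b : R) : 0 < b -> ln b + alpha * a = c ->
  forall x, response (fun=> a) x = b.
Proof.
move=> b0 E x; rewrite /response conv_cst// mulrA -E addrK lnK//.
Qed.

Lemma response_le (g h : R -> R) x : convolution K g x <= convolution K h x ->
  response h x <= response g x.
Proof. by move=> gh; rewrite ler_expR lerD2l lerN2 ler_pM2l. Qed.

Lemma response_bounds (h : R -> R) : bounded_measurable h ->
  (forall x, rm <= h x <= rp) -> forall x, rm <= response h x <= rp.
Proof.
move=> bh hb x; rewrite -{1}(response_cst rp rm rm0 ELm x) -{2}(response_cst rm rp rp0 ELp x).
apply/andP; split; apply: response_le; apply: conv_le => //; try exact: bm_cst.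
  by move=> y; case/andP: (hb y).
by move=> y; case/andP: (hb y).
Qed.

(** Convexity of the exponential, with the slope taken at the first argument: this
    one-sided form is what keeps the bounds of [comparison_from_core] in terms of
    v1 and w2 alone. *)
Lemma response_sub (g h : R -> R) x : bounded_measurable g -> bounded_measurable h ->
  response g x - response h x <= response g x * (beta * convolution K (fun y => h y - g y) x).
Proof.
move=> bg bh; rewrite convB//; apply: le_trans (expR_sub_le _ _) _.
rewrite ler_wpM2l ?expR_ge0//; lra.
Qed.

Definition response_lip : R := rp * (beta * (K 0 * (rp - rm))).

Let response_lip_ge0 : 0 <= response_lip.
Proof. by rewrite /response_lip !mulr_ge0// ?ltW// subr_gt0. Qed.

Lemma response_lipschitz (h : R -> R) x y :
  nondecreasing_fun h \/ nonincreasing_fun h -> (forall t, rm <= h t <= rp) ->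
  `|response h x - response h y| <= response_lip * `|x - y|.
Proof.
move=> mh hb.
have bh : bounded_measurable h.
  by case: mh => mh; [exact: bm_nondecreasing mh hb|exact: bm_nonincreasing mh hb].
have L s t : response h s - response h t <= response_lip * `|s - t|.
  apply: le_trans (expR_sub_le _ _) _; rewrite -/(response h s).
  have /andP[r1 r2] := response_bounds _ bh hb s.
  rewrite (_ : _ - _ = beta * (convolution K h t - convolution K h s)); last by ring.
  have H := conv_lipschitz _ _ _ t s mh hb.
  have H1 := le_trans (ler_norm _) H; rewrite distrC in H1.
  apply: (@le_trans _ _ (response h s * (beta * (K 0 * (rp - rm) * `|s - t|)))).
    by rewrite ler_wpM2l ?(le_trans (ltW rm0) r1)// ler_wpM2l// ltW.
  rewrite (_ : response_lip * _ = rp * (beta * (K 0 * (rp - rm) * `|s - t|))); last first.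
    by rewrite /response_lip; ring.
  by rewrite ler_wpM2r// !mulr_ge0// ?ltW// subr_gt0.
rewrite ler_norml L andbT lerNl opprB.
by rewrite distrC L.
Qed.

Record solution (m n : R -> R) : Prop := Solution {
  sol_bm1 : bounded_measurable m;
  sol_bm2 : bounded_measurable n;
  sol_cts1 : continuous m;
  sol_cts2 : continuous n;
  sol_ge1 : forall x, rm <= m x <= rp;
  sol_ge2 : forall x, rm <= n x <= rp;
  sol_eq1 : forall x, m x = response n x;
  sol_eq2 : forall x, n x = response m x }.

Lemma solution_sym m n : solution m n -> solution n m.
Proof. by case. Qed.

(** Equality of the first components at z means equality of K * v2 and K * w2
    at z, while w2 - v2 has a constant sign. *)
Lemma contact_spreads (v1 v2 w1 w2 : R -> R) r z : 0 < r -> 0 < K r ->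
  solution v1 v2 -> solution w1 w2 -> (forall x, w2 x <= v2 x) -> v1 z = w1 z ->
  forall y, `|z - y| < r -> v2 y = w2 y.
Proof.
move=> r0 Kr sv sw le2 touch y zy.
have bD : bounded_measurable (fun x => w2 x - v2 x).
  by apply: bmB; [case: sw|case: sv].
have cD : continuous (fun x => w2 x - v2 x).
  by move=> x; apply: cvgB; [exact: (sol_cts2 _ _ sw)|exact: (sol_cts2 _ _ sv)].
have D0 x : w2 x - v2 x <= 0 by rewrite subr_le0.
have cv0 : convolution K (fun x => w2 x - v2 x) z = 0.
  rewrite convB//; [|by case: sw|by case: sv].
  move: touch; rewrite (sol_eq1 _ _ sv) (sol_eq1 _ _ sw) => /expR_inj/addrI/oppr_inj.
  by move/(mulfI (lt0r_neq0 beta0)) => ->; rewrite subrr.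
have /eqP := conv_eq0_near _ _ _ r0 Kr bD cD D0 cv0 y zy.
by rewrite subr_eq0 => /eqP.
Qed.

(** Contact spreads from one component to the other and by a distance r at each
    step, so it reaches every point. *)
Lemma strong_comparison (v1 v2 w1 w2 : R -> R) z :
  solution v1 v2 -> solution w1 w2 ->
  (forall x, v1 x <= w1 x) -> (forall x, w2 x <= v2 x) ->
  v1 z = w1 z \/ v2 z = w2 z -> forall x, v1 x = w1 x /\ v2 x = w2 x.
Proof.
move=> sv sw le1 le2 touch.
have [r [r0 Kr]] := kernel_pos_radius mass0.
have sv' := solution_sym _ _ sv; have sw' := solution_sym _ _ sw.
have s1 x y : v1 x = w1 x -> `|x - y| < r -> v2 y = w2 y.
  by move=> t; exact: (contact_spreads v1 v2 w1 w2 r x).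
have s2 x y : v2 x = w2 x -> `|x - y| < r -> v1 y = w1 y.
  by move=> /esym t xy; apply/esym; exact: (contact_spreads w2 w1 v2 v1 r x).
have self x : `|x - x| < r by rewrite subrr normr0.
pose P x := v1 x = w1 x /\ v2 x = w2 x.
have step x y : P x -> `|x - y| < r -> P y.
  by move=> [p1 p2] xy; split; [exact: (s2 x)|exact: (s1 x)].
have Pz : P z.
  by case: touch => t; split=> //; [exact: (s1 z)|exact: (s2 z)].
move=> x; change (P x).
have [N Nr] : exists N : nat, `|x - z| < N.+1%:R * r.
  exists (Num.truncn (`|x - z| / r)); rewrite -ltr_pdivrMr//.
  exact: truncnS_gt.
(* Equal steps, each shorter than r. *)
pose t := (x - z) / N.+1%:R.
have N0 : 0 < N.+1%:R :> R by [].
have tr : `|t| < r by rewrite normrM normfV (ger0_norm (ltW N0)) ltr_pdivrMr// mulrC.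
have Pk (k : nat) : P (z + k%:R * t).
  elim: k => [|k IH]; first by rewrite mul0r addr0.
  apply: (step _ _ IH); rewrite -natr1 mulrDl mul1r addrA opprD addrA subrr sub0r normrN//.
have := Pk N.+1; congr P; rewrite /t mulrCA divff ?gt_eqF// mulr1; ring.
Qed.

(** On E, substituting one inequality into the other bounds P by
    alpha^2 p q times its own supremum. The last hypothesis says that no mass
    enters from outside E within the range A of K. *)
Lemma coupled_subsolution_eq0 (P Q : R -> R) (E : set R) (A p q : R) :
  (forall s : R, A < `|s| -> K s = 0) ->
  bounded_measurable P -> bounded_measurable Q ->
  (forall x, 0 <= P x) -> (forall x, 0 <= Q x) ->
  0 <= p -> 0 <= q -> alpha ^+ 2 * p * q < 1 ->
  (forall x, E x -> P x <= p * (beta * convolution K Q x)) ->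
  (forall x, E x -> Q x <= q * (beta * convolution K P x)) ->
  (forall x y, E x -> `|x - y| <= A -> ~ E y -> P y = 0 /\ Q y = 0) ->
  forall x, E x -> P x = 0 /\ Q x = 0.
Proof.
move=> KA bP bQ P0 Q0 p0 q0 pq1 EP EQ bd.
have spread (F : R -> R) s : bounded_measurable F -> 0 <= s ->
    (forall x, E x -> F x <= s) -> (forall x y, E x -> `|x - y| <= A -> ~ E y -> F y = 0) ->
    forall x, E x -> beta * convolution K F x <= alpha * s.
  move=> bF s0 Fs Fb x Ex; rewrite -mulrA ler_pM2l// -(conv_cst s x).
  apply: (conv_local _ _ _ _ KA) => // [|y xy]; first exact: bm_cst.
  have [/Fs//|nEy] := pselect (E y).
  by rewrite (Fb x y).
have bd1 x y : E x -> `|x - y| <= A -> ~ E y -> P y = 0 by move=> Ex xy /(bd x y Ex xy)[].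
have bd2 x y : E x -> `|x - y| <= A -> ~ E y -> Q y = 0 by move=> Ex xy /(bd x y Ex xy)[].
have QP s : 0 <= s -> (forall x, E x -> P x <= s) -> forall x, E x -> Q x <= q * (alpha * s).
  move=> s0 Ps x Ex; apply: le_trans (EQ _ Ex) _; rewrite ler_wpM2l//.
  exact: (spread P).
have PQ s : 0 <= s -> (forall x, E x -> Q x <= s) -> forall x, E x -> P x <= p * (alpha * s).
  move=> s0 Ps x Ex; apply: le_trans (EP _ Ex) _; rewrite ler_wpM2l//.
  exact: (spread Q).
have [_ [M PM]] := bP.
move=> x0 Ex0.
pose S := sup (P @` E).
have hS : has_sup (P @` E).
  split; first by exists (P x0), x0.
  by exists M => _ [x _ <-]; rewrite (le_trans (ler_norm _)).
have PS x : E x -> P x <= S by move=> Ex; apply: sup_upper_bound => //; exists x.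
have S0 : 0 <= S by exact: le_trans (PS _ Ex0).
have aS : 0 <= alpha * S by rewrite mulr_ge0// ltW.
have QS x : E x -> Q x <= q * (alpha * S) by apply: QP.
have PS' := PQ _ (mulr_ge0 q0 aS) QS.
have SS : S <= alpha ^+ 2 * p * q * S.
  rewrite {1}/S; apply: ge_sup; first by exists (P x0), x0.
  move=> _ [x Ex <-]; apply: le_trans (PS' x Ex) _.
  by rewrite le_eqVlt; apply/orP; left; apply/eqP; ring.
have SE : S = 0.
  apply/eqP; rewrite eq_le S0 andbT leNgt; apply/negP => Sp.
  by move: SS; rewrite -{1}[S]mul1r ler_pM2r// leNgt pq1.
split; apply/eqP; rewrite eq_le ?P0 ?Q0 andbT.
  by rewrite (le_trans (PS _ Ex0))// SE.
by rewrite (le_trans (QS _ Ex0))// SE !mulr0.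
Qed.

Lemma bm_max0 (f : R -> R) : bounded_measurable f ->
  bounded_measurable (fun x => Num.max (f x) 0).
Proof.
move=> [mf [M fM]]; split.
  by apply: measurable_maxr => //; exact: measurable_cst.
exists M => x; rewrite ger0_norm ?le_max ?lexx ?orbT//.
by rewrite ge_max (le_trans (ler_norm _))//= (le_trans _ (fM x)).
Qed.

(** Applied on the left half-line with coefficients (rm + d, rp) and on the right
    one with (rp, rm + d): the coefficient in the bound for the positive part of
    v1 - w1 is v1, and that for w2 - v2 is w2. Thus v is required to be near its
    limit on the left and w on the right, which remains true when w is translated
    to the left. The core is longer than the range A of K, so the two half-lines
    do not interact. *)
Lemma comparison_from_core (v1 v2 w1 w2 : R -> R) (A X d : R) :
  (forall s : R, A < `|s| -> K s = 0) -> 0 < A -> A <= X ->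
  0 <= d -> alpha ^+ 2 * (rm + d) * rp < 1 ->
  solution v1 v2 -> solution w1 w2 ->
  (forall x, x < - X -> v1 x <= rm + d) -> (forall x, X < x -> w2 x <= rm + d) ->
  (forall x, - X <= x <= X -> v1 x <= w1 x /\ w2 x <= v2 x) ->
  forall x, v1 x <= w1 x /\ w2 x <= v2 x.
Proof.
move=> KA A0 AX d0 st sv sw vl wr core.
have bv1 := sol_bm1 _ _ sv; have bv2 := sol_bm2 _ _ sv.
have bw1 := sol_bm1 _ _ sw; have bw2 := sol_bm2 _ _ sw.
pose P x := Num.max (v1 x - w1 x) 0; pose Q x := Num.max (w2 x - v2 x) 0.
have bP : bounded_measurable P by apply: bm_max0; exact: bmB.
have bQ : bounded_measurable Q by apply: bm_max0; exact: bmB.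
have P0 x : 0 <= P x by rewrite le_max lexx orbT.
have Q0 x : 0 <= Q x by rewrite le_max lexx orbT.
have cP x : 0 <= beta * convolution K P x.
  rewrite mulr_ge0 ?(ltW beta0)//; have := conv_le (fun=> 0) _ x (bm_cst 0) bP P0.
  by rewrite conv_cst// mulr0.
have cQ x : 0 <= beta * convolution K Q x.
  rewrite mulr_ge0 ?(ltW beta0)//; have := conv_le (fun=> 0) _ x (bm_cst 0) bQ Q0.
  by rewrite conv_cst// mulr0.
have PE x : P x <= v1 x * (beta * convolution K Q x).
  have /andP[v0 _] := sol_ge1 _ _ sv x.
  have v00 := le_trans (ltW rm0) v0.
  rewrite /P ge_max mulr_ge0// andbT {1}(sol_eq1 _ _ sv) (sol_eq1 _ _ sw).
  apply: le_trans (response_sub _ _ _ bv2 bw2) _.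
  rewrite -(sol_eq1 _ _ sv) ler_wpM2l// ler_wpM2l// ?(ltW beta0)//.
  by apply: conv_le => // [|y]; [exact: bmB|rewrite /Q le_max lexx].
have QE x : Q x <= w2 x * (beta * convolution K P x).
  have /andP[v0 _] := sol_ge2 _ _ sw x.
  have v00 := le_trans (ltW rm0) v0.
  rewrite /Q ge_max mulr_ge0// andbT {1}(sol_eq2 _ _ sw) (sol_eq2 _ _ sv).
  apply: le_trans (response_sub _ _ _ bw1 bv1) _.
  rewrite -(sol_eq2 _ _ sw) ler_wpM2l// ler_wpM2l// ?(ltW beta0)//.
  by apply: conv_le => // [|y]; [exact: bmB|rewrite /P le_max lexx].
have core0 x : - X <= x <= X -> P x = 0 /\ Q x = 0.
  move=> /core[h1 h2]; split; apply/eqP; rewrite eq_le ?P0 ?Q0 andbT ge_max lexx andbT; lra.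
have rd0 : 0 <= rm + d by rewrite addr_ge0// ltW.
have left0 x : x < - X -> P x = 0 /\ Q x = 0.
  apply: (@coupled_subsolution_eq0 P Q [set x | x < - X] A (rm + d) rp) => //=.
  - exact: ltW.
  - by move=> y /vl vy; apply: le_trans (PE y) _; rewrite ler_wpM2r.
  - move=> y _; apply: le_trans (QE y) _; rewrite ler_wpM2r//.
    by case/andP: (sol_ge2 _ _ sw y).
  - move=> y z yX /ler_normlP[h1 h2] /negP; rewrite -leNgt => zX.
    by apply: core0; apply/andP; split; lra.
have right0 x : X < x -> P x = 0 /\ Q x = 0.
  apply: (@coupled_subsolution_eq0 P Q [set x | X < x] A rp (rm + d)) => //=.
  - exact: ltW.
  - by rewrite mulrAC.
  - move=> y _; apply: le_trans (PE y) _; rewrite ler_wpM2r//.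
    by case/andP: (sol_ge1 _ _ sv y).
  - by move=> y /wr vy; apply: le_trans (QE y) _; rewrite ler_wpM2r.
  - move=> y z yX /ler_normlP[h1 h2] /negP; rewrite -leNgt => zX.
    by apply: core0; apply/andP; split; lra.
move=> x.
have [p q] : P x = 0 /\ Q x = 0.
  have [|xl] := ltP x (- X); first exact: left0.
  have [|xr] := ltP X x; first exact: right0.
  by apply: core0; rewrite xl.
split; rewrite -subr_le0; [rewrite -p|rewrite -q]; by rewrite le_max lexx.
Qed.

(** * Fronts and the sliding argument *)

(** Critical points in a form stable under translations, flips and limits. The
    limits at infinity are stated as one-sided conditions, which together with the
    bounds and the monotonicity are equivalent to convergence. *)
Record front (m n : R -> R) : Prop := Front {
  front_nd : nondecreasing_fun m;
  front_ni : nonincreasing_fun n;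
  front_ge1 : forall x, rm <= m x <= rp;
  front_ge2 : forall x, rm <= n x <= rp;
  front_m_ninfty : forall e, 0 < e -> exists X, m X < rm + e;
  front_m_pinfty : forall e, 0 < e -> exists X, rp - e < m X;
  front_n_pinfty : forall e, 0 < e -> exists X, n X < rm + e;
  front_n_ninfty : forall e, 0 < e -> exists X, rp - e < n X;
  front_eq1 : forall x, m x = response n x;
  front_eq2 : forall x, n x = response m x }.

Lemma front_lip1 m n : front m n -> forall x y, `|m x - m y| <= response_lip * `|x - y|.
Proof.
move=> fr x y; rewrite !(front_eq1 _ _ fr); apply: response_lipschitz => //.
  by right; exact: front_ni fr.
exact: front_ge2 fr.
Qed.

Lemma front_lip2 m n : front m n -> forall x y, `|n x - n y| <= response_lip * `|x - y|.
Proof.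
move=> fr x y; rewrite !(front_eq2 _ _ fr); apply: response_lipschitz => //.
  by left; exact: front_nd fr.
exact: front_ge1 fr.
Qed.

Lemma front_solution m n : front m n -> solution m n.
Proof.
move=> fr; split.
- exact: bm_nondecreasing (front_nd _ _ fr) (front_ge1 _ _ fr).
- exact: bm_nonincreasing (front_ni _ _ fr) (front_ge2 _ _ fr).
- exact: lipschitz_continuous (front_lip1 _ _ fr).
- exact: lipschitz_continuous (front_lip2 _ _ fr).
- exact: front_ge1 fr.
- exact: front_ge2 fr.
- exact: front_eq1 fr.
- exact: front_eq2 fr.
Qed.

Lemma response_shift h a x : bounded_measurable h ->
  response (fun y => h (y + a)) x = response h (x + a).
Proof. by move=> bh; rewrite /response conv_shift. Qed.

Lemma response_opp h x : bounded_measurable h ->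
  response (fun y => h (- y)) x = response h (- x).
Proof. by move=> bh; rewrite /response conv_opp. Qed.

Lemma front_shift m n a : front m n -> front (fun x => m (x + a)) (fun x => n (x + a)).
Proof.
move=> fr; have [bm bn _ _ _ _ _ _] := front_solution _ _ fr.
case: fr => nd ni g1 g2 l1 l2 l3 l4 e1 e2; split.
- by move=> x y xy; apply: nd; rewrite lerD2r.
- by move=> x y xy; apply: ni; rewrite lerD2r.
- by move=> x; exact: g1.
- by move=> x; exact: g2.
- by move=> e /l1[X HX]; exists (X - a); rewrite subrK.
- by move=> e /l2[X HX]; exists (X - a); rewrite subrK.
- by move=> e /l3[X HX]; exists (X - a); rewrite subrK.
- by move=> e /l4[X HX]; exists (X - a); rewrite subrK.
- by move=> x; rewrite (response_shift _ _ _ bn) -e1.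
- by move=> x; rewrite (response_shift _ _ _ bm) -e2.
Qed.

Lemma front_flip m n : front m n -> front (fun x => n (- x)) (fun x => m (- x)).
Proof.
move=> fr; have [bm bn _ _ _ _ _ _] := front_solution _ _ fr.
case: fr => nd ni g1 g2 l1 l2 l3 l4 e1 e2; split.
- by move=> x y xy; apply: ni; rewrite lerN2.
- by move=> x y xy; apply: nd; rewrite lerN2.
- by move=> x; exact: g2.
- by move=> x; exact: g1.
- by move=> e /l3[X HX]; exists (- X); rewrite opprK.
- by move=> e /l4[X HX]; exists (- X); rewrite opprK.
- by move=> e /l1[X HX]; exists (- X); rewrite opprK.
- by move=> e /l2[X HX]; exists (- X); rewrite opprK.
- by move=> x; rewrite (response_opp _ _ bm) -e2.
- by move=> x; rewrite (response_opp _ _ bn) -e1.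
Qed.

Lemma solution_phase : solution (fun=> rp) (fun=> rm).
Proof.
split; try exact: bm_cst; try exact: cst_continuous.
- by move=> x; rewrite lexx ltW.
- by move=> x; rewrite lexx ltW.
- by move=> x; rewrite (response_cst rm rp).
- by move=> x; rewrite (response_cst rp rm).
Qed.

(** Strong comparison with the constant state (rp, rm), which a front lies below
    and cannot equal. *)
Lemma front_strict_pinfty m n x : front m n -> m x < rp /\ rm < n x.
Proof.
move=> fr.
suff H : ~ (m x = rp \/ n x = rm).
  have /andP[_ h1] := front_ge1 _ _ fr x; have /andP[h2 _] := front_ge2 _ _ fr x.
  split; rewrite lt_neqAle ?h1 ?h2 andbT; apply/eqP => E; apply: H; [by left|by right].
move=> H.
have E := strong_comparison _ _ _ _ x
  (front_solution _ _ fr) solution_phase.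
have d0 : 0 < (rp - rm) / 2 by rewrite divr_gt0// subr_gt0.
have [X HX] := front_m_ninfty _ _ fr ((rp - rm) / 2) d0.
have [] := E _ _ H X.
- by move=> y; have /andP[] := front_ge1 _ _ fr y.
- by move=> y; have /andP[] := front_ge2 _ _ fr y.
- by move=> mX; lra.
Qed.

Lemma front_strict_ninfty m n x : front m n -> rm < m x /\ n x < rp.
Proof. by move=> /front_flip/(front_strict_pinfty _ _ (- x)); rewrite opprK => -[]. Qed.

Lemma tail_margin : exists d : R, 0 < d /\ alpha ^+ 2 * (rm + d) * rp < 1.
Proof.
have a2 : 0 < alpha ^+ 2 * rp by rewrite mulr_gt0// exprn_gt0.
exists ((1 - alpha ^+ 2 * rm * rp) / 2 / (alpha ^+ 2 * rp)); split.
  by rewrite !divr_gt0// subr_gt0.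
pose t := alpha ^+ 2 * rm * rp; have t1 : t < 1 := stable; rewrite -/t.
set q := _ / _ / _; have -> : alpha ^+ 2 * (rm + q) * rp = t + q * (alpha ^+ 2 * rp).
  by rewrite /t; ring.
rewrite /q divfK ?lt0r_neq0//; lra.
Qed.

Section sliding.
Variables v1 v2 w1 w2 : R -> R.
Hypothesis fv : front v1 v2.
Hypothesis fw : front w1 w2.

Definition dominates (a : R) : Prop :=
  forall x, v1 x <= w1 (x + a) /\ w2 (x + a) <= v2 x.

(** The length X depends only on a lower bound a0 for the translations, because
    a larger translation only improves the tail of w2 on the right. *)
Lemma dominates_from_core (a0 : R) : exists X : R, 0 < X /\ forall a, a0 <= a ->
  (forall x, - X <= x <= X -> v1 x <= w1 (x + a) /\ w2 (x + a) <= v2 x) -> dominates a.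
Proof.
have [d [d0 st]] := tail_margin.
have [A [A0 KA]] := kernel_support.
have [Y vY] := front_m_ninfty _ _ fv d d0.
have [Z wZ] := front_n_pinfty _ _ fw d d0.
pose X := Num.max A (Num.max (- Y) (Z - a0)).
have XA : A <= X by rewrite /X le_max lexx.
have XY : - Y <= X by rewrite /X !le_max lexx orbT.
have XZ : Z - a0 <= X by rewrite /X !le_max lexx !orbT.
exists X; split; first exact: lt_le_trans XA.
move=> a aa0 core.
have sw := front_solution _ _ (front_shift _ _ a fw).
apply: (comparison_from_core v1 v2 _ _ A X d KA A0 XA (ltW d0) st (front_solution _ _ fv) sw)
  => //.
- move=> x xX; apply: le_trans (ltW vY); apply: (front_nd _ _ fv); lra.
- move=> x xX; apply: le_trans (ltW wZ); apply: (front_ni _ _ fw); lra.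
Qed.

Lemma dominates_exists : exists a, dominates a.
Proof.
have [X [X0 H]] := dominates_from_core 0.
have [v1X v2X] := front_strict_pinfty _ _ X fv.
have [Y wY] := front_m_pinfty _ _ fw (rp - v1 X) ltac:(lra).
have [Z wZ] := front_n_pinfty _ _ fw (v2 X - rm) ltac:(lra).
pose a := Num.max 0 (Num.max (Y + X) (Z + X)).
have a0 : 0 <= a by rewrite /a le_max lexx.
have aY : Y + X <= a by rewrite /a !le_max lexx orbT.
have aZ : Z + X <= a by rewrite /a !le_max lexx !orbT.
exists a; apply: H => // x /andP[x1 x2]; split.
- apply: (@le_trans _ _ (v1 X)); first exact: front_nd fv _ _ x2.
  have : w1 Y <= w1 (x + a) by apply: (front_nd _ _ fw); lra.
  lra.
- apply: (@le_trans _ _ (v2 X)); last exact: front_ni fv _ _ x2.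
  have : w2 (x + a) <= w2 Z by apply: (front_ni _ _ fw); lra.
  lra.
Qed.

Lemma dominates_bounded : exists Y, forall a, dominates a -> Y <= a.
Proof.
have [v10 _] := front_strict_ninfty _ _ 0 fv.
have [Y wY] := front_m_ninfty _ _ fw (v1 0 - rm) ltac:(lra).
exists Y => a /(_ 0)[]; rewrite add0r => H _.
rewrite leNgt; apply/negP => /ltW/(front_nd _ _ fw); lra.
Qed.

Lemma lip_margin (e : R) : 0 < e -> exists d : R, 0 < d /\ response_lip * d < e.
Proof.
move=> e0; exists (e / (response_lip + 1)); split; first by rewrite divr_gt0// ltr_wpDl.
rewrite mulrCA -[ltRHS]mulr1 ltr_pM2l// ltr_pdivrMr ?ltr_wpDl//; lra.
Qed.

(** Let a be the infimum of the dominating translations; it is dominating by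
    continuity. Without contact, the two gaps would have a positive minimum on the
    core, so a slightly smaller translation would still dominate there, hence
    everywhere. *)
Lemma sliding_touches : exists a z, dominates a /\ (v1 z = w1 (z + a) \/ v2 z = w2 (z + a)).
Proof.
pose S : set R := dominates.
have hS : has_inf S.
  split; first by have [a Sa] := dominates_exists; exists a.
  by have [Y HY] := dominates_bounded; exists Y => a /HY.
pose a := inf S.
have near e : 0 < e -> exists b, [/\ dominates b, a <= b & b < a + e].
  move=> e0; have [b Sb be] := inf_adherent e0 hS; exists b; split=> //.
  by apply: ge_inf => //; case: hS.
have Sa : dominates a.
  move=> x; split; rewrite leNgt; apply/negP => gap.
  - have [d [d0 ld]] := lip_margin (v1 x - w1 (x + a)) ltac:(lra).
    have [b [/(_ x)[h _] ab bd]] := near _ d0.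
    have := le_trans (ler_norm _) (front_lip1 _ _ fw (x + b) (x + a)).
    have -> : x + b - (x + a) = b - a by ring.
    rewrite ger0_norm ?subr_ge0// => L.
    have : response_lip * (b - a) <= response_lip * d by apply: ler_wpM2l => //; lra.
    lra.
  - have [d [d0 ld]] := lip_margin (w2 (x + a) - v2 x) ltac:(lra).
    have [b [/(_ x)[_ h] ab bd]] := near _ d0.
    have := le_trans (ler_norm _) (front_lip2 _ _ fw (x + a) (x + b)).
    have -> : x + a - (x + b) = - (b - a) by ring.
    rewrite normrN ger0_norm ?subr_ge0// => L.
    have : response_lip * (b - a) <= response_lip * d by apply: ler_wpM2l => //; lra.
    lra.
exists a; apply: contrapT => nt.
have sep x : v1 x < w1 (x + a) /\ w2 (x + a) < v2 x.
  have [h1 h2] := Sa x.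
  by split; rewrite lt_neqAle ?h1 ?h2 andbT; apply/eqP => E; apply: nt; exists x;
    split=> //; [left|right].
have [X [X0 HX]] := dominates_from_core (a - 1).
have XX : - X <= X by lra.
have sv := front_solution _ _ fv.
have sw := front_solution _ _ (front_shift _ _ a fw).
have c1 : {within `[- X, X], continuous (fun x => w1 (x + a) - v1 x)}.
  apply: continuous_subspaceT => x.
  by apply: cvgB; [exact: (sol_cts1 _ _ sw)|exact: (sol_cts1 _ _ sv)].
have c2 : {within `[- X, X], continuous (fun x => v2 x - w2 (x + a))}.
  apply: continuous_subspaceT => x.
  by apply: cvgB; [exact: (sol_cts2 _ _ sv)|exact: (sol_cts2 _ _ sw)].
have [y1 _ m1] := EVT_min XX c1; have [y2 _ m2] := EVT_min XX c2.
have [p1 _] := sep y1; have [_ p2] := sep y2.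
pose eta := Num.min (w1 (y1 + a) - v1 y1) (v2 y2 - w2 (y2 + a)).
have eta0 : 0 < eta by rewrite lt_min; apply/andP; split; lra.
have [d [d0 ld]] := lip_margin eta eta0.
pose e := Num.min d 1.
have e0 : 0 < e by rewrite lt_min d0 ltr01.
have [ed e1] : e <= d /\ e <= 1 by rewrite /e !ge_min !lexx orbT.
have le : response_lip * e <= eta.
  by apply: le_trans (ltW ld); apply: ler_wpM2l.
have good : dominates (a - e).
  apply: HX; first by lra.
  move=> x xX.
  have := m1 x; have := m2 x; rewrite in_itv/= => /(_ xX) h2 /(_ xX) h1.
  have [et1 et2] : eta <= w1 (y1 + a) - v1 y1 /\ eta <= v2 y2 - w2 (y2 + a).
    by rewrite /eta !ge_min !lexx orbT.
  have := le_trans (ler_norm _) (front_lip1 _ _ fw (x + a) (x + (a - e))).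
  have := le_trans (ler_norm _) (front_lip2 _ _ fw (x + (a - e)) (x + a)).
  rewrite (distrC (x + (a - e))).
  have -> : x + a - (x + (a - e)) = e by ring.
  rewrite gtr0_norm// => *; split; lra.
have : a <= a - e by apply: ge_inf => //; case: hS.
lra.
Qed.

Lemma front_unique : exists a : R, forall x, v1 x = w1 (x + a) /\ v2 x = w2 (x + a).
Proof.
have [a [z [dom touch]]] := sliding_touches; exists a.
have sw := front_solution _ _ (front_shift _ _ a fw).
apply: (strong_comparison _ _ _ _ z (front_solution _ _ fv) sw) => //.
- by move=> x; case: (dom x).
- by move=> x; case: (dom x).
Qed.

End sliding.

(** A front equal at x to its translate by y - x > 0 would be periodic by strong
    comparison, hence constant. *)
Lemma front_increasing m n x y : front m n -> x < y -> m x < m y.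
Proof.
move=> fr xy; rewrite lt_neqAle (front_nd _ _ fr _ _ (ltW xy)) andbT; apply/eqP => E.
pose a := y - x; have a0 : 0 < a by rewrite subr_gt0.
have sw := front_solution _ _ (front_shift _ _ a fr).
have per : forall z, m z = m (z + a) /\ n z = n (z + a).
  apply: (strong_comparison _ _ _ _ x (front_solution _ _ fr) sw).
  - by move=> z; apply: (front_nd _ _ fr); lra.
  - by move=> z; apply: (front_ni _ _ fr); lra.
  - by left; rewrite E /a; congr m; ring.
have perk k : m x = m (x + k%:R * a).
  elim: k => [|k ->]; first by rewrite mul0r addr0.
  by have [-> _] := per (x + k%:R * a); rewrite -natr1; congr m; ring.
have [mx _] := front_strict_pinfty _ _ x fr.
have [Z mZ] := front_m_pinfty _ _ fr (rp - m x) ltac:(lra).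
have [k kZ] : exists k : nat, Z - x < k%:R * a.
  exists (Num.truncn ((Z - x) / a)).+1; rewrite -ltr_pdivrMr//; exact: truncnS_gt.
have : m Z <= m (x + k%:R * a) by apply: (front_nd _ _ fr); lra.
by rewrite -perk; lra.
Qed.

Lemma front_crossing_unique m n x y : front m n -> m x = n x -> m y = n y -> x = y.
Proof.
move=> fr; wlog xy : x y / x < y.
  move=> W Ex Ey; case: (ltgtP x y) => // xy; first exact: W.
  by apply/esym; apply: W.
move=> Ex Ey; have := front_increasing _ _ _ _ fr xy.
have := front_ni _ _ fr _ _ (ltW xy); lra.
Qed.

Lemma front_of_profiles (m n : R -> R) :
  incr_profile rm rp m -> decr_profile rp rm n ->
  (forall x, ln (m x) + beta * convolution K n x = c /\
             ln (n x) + beta * convolution K m x = c) ->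
  front m n.
Proof.
move=> [_ mnd ml mr] [_ nni nl nr] EL.
have mb := nondecreasing_profile_bounds _ _ _ mnd ml mr.
have nnd : nondecreasing_fun (fun x => n (- x)).
  by move=> x y xy; apply: nni; rewrite lerN2.
have nb x : rm <= n x <= rp.
  have := nondecreasing_profile_bounds _ rm rp nnd ((cvg_pinfty_opp _ _).1 nr)
    ((cvg_ninfty_opp _ _).1 nl) (- x).
  by rewrite opprK.
have eqn (h g : R -> R) x : rm <= h x <= rp -> ln (h x) + beta * convolution K g x = c ->
    h x = response g x.
  move=> /andP[h0 _] E; rewrite /response -E addrK lnK// posrE.
  exact: lt_le_trans h0.
split=> //.
- move=> e e0; have [X HX] := (cvg_ninftyP _ _).1 ml e e0; exists (X - 1).
  by have := HX (X - 1); rewrite ltr_norml => /(_ ltac:(lra))/andP[? ?]; lra.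
- move=> e e0; have [X HX] := (cvg_pinftyP _ _).1 mr e e0; exists (X + 1).
  by have := HX (X + 1); rewrite ltr_norml => /(_ ltac:(lra))/andP[? ?]; lra.
- move=> e e0; have [X HX] := (cvg_pinftyP _ _).1 nr e e0; exists (X + 1).
  by have := HX (X + 1); rewrite ltr_norml => /(_ ltac:(lra))/andP[? ?]; lra.
- move=> e e0; have [X HX] := (cvg_ninftyP _ _).1 nl e e0; exists (X - 1).
  by have := HX (X - 1); rewrite ltr_norml => /(_ ltac:(lra))/andP[? ?]; lra.
- by move=> x; apply: eqn => //; case: (EL x).
- by move=> x; apply: eqn => //; case: (EL x).
Qed.

Lemma profiles_of_front (m n : R -> R) : front m n ->
  [/\ incr_profile rm rp m, decr_profile rp rm n &
      forall x, ln (m x) + beta * convolution K n x = c /\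
                ln (n x) + beta * convolution K m x = c].
Proof.
move=> fr; have [_ _ cm cn _ _ _ _] := front_solution _ _ fr.
have [mnd nni mb nb l1 l2 l3 l4 e1 e2] := fr.
have [nnd _ nb' _ k1 k2 _ _ _ _] := front_flip _ _ fr.
split.
- split=> //.
  + by move=> x; apply: cvg_at_right_filter; exact: cm.
  + by apply: nondecreasing_cvg_ninfty => // x; case/andP: (mb x).
  + by apply: nondecreasing_cvg_pinfty => // x; case/andP: (mb x).
- split=> //.
  + by move=> x; apply: cvg_at_right_filter; exact: cn.
  + by apply/cvg_ninfty_opp; apply: nondecreasing_cvg_pinfty => // x; case/andP: (nb' x).
  + by apply/cvg_pinfty_opp; apply: nondecreasing_cvg_ninfty => // x; case/andP: (nb' x).
- by move=> x; rewrite e1 e2 /response !expRK !subrK.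
Qed.

(** * Energy dissipation along alternating minimization *)

(** With kappa = c + 1, psi is the contribution t ln t - kappa t of one species, and
    bulk is the free energy density f of homogeneous states. *)
Definition psi (t : R) : R := t * ln t - (c + 1) * t.
Definition bulk (s t : R) : R := psi s + psi t + alpha * s * t.
Notation g := (bulk rp rm).
Hypothesis bulk_min : forall s t : R, 0 <= s -> 0 <= t -> g <= bulk s t.
Hypothesis bulk_argmin : forall s t : R, 0 <= s -> 0 <= t -> bulk s t <= g ->
  (s = rp /\ t = rm) \/ (s = rm /\ t = rp).

Lemma bulkC s t : bulk s t = bulk t s.
Proof. by rewrite /bulk; ring. Qed.

(** Profiles that differ from the step only on a bounded set. *)
Record ramp (u : R -> R) : Prop := Ramp {
  ramp_nd : nondecreasing_fun u;
  ramp_bounds : forall x, rm <= u x <= rp;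
  ramp_far : exists L : R, forall x, L < x -> u x = rp /\ u (- x) = rm }.

Definition step_ramp (x : R) : R := if 0 <= x then rp else rm.
(** One half-step of the alternating minimization. A half-step turns an increasing
    profile of one species into a decreasing profile of the other; the reflection
    makes all iterates increasing, and both half-steps instances of one map. *)
Definition reflected_response (u : R -> R) (x : R) : R := response u (- x).
Notation S := reflected_response.

Lemma reflected_responseE u x : S u x = response u (- x).
Proof. by []. Qed.

Lemma reflected_response_opp u x : S u (- x) = response u x.
Proof. by rewrite reflected_responseE opprK. Qed.

Opaque reflected_response.

Lemma ramp_step : ramp step_ramp.
Proof.
split.
- move=> x y xy; rewrite /step_ramp; case: ifPn => x0; case: ifPn => y0 //; last exact: ltW.
  by move: y0; rewrite (le_trans x0 xy).
- by move=> x; rewrite /step_ramp; case: ifP => _; rewrite lexx ltW.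
- exists 0 => x x0; rewrite /step_ramp ltW// oppr_ge0 leNgt x0//.
Qed.

Lemma ramp_bm u : ramp u -> bounded_measurable u.
Proof. by move=> ru; exact: bm_nondecreasing (ramp_nd _ ru) (ramp_bounds _ ru). Qed.

Lemma ramp_far_response u : ramp u -> exists L : R, forall x, L < x ->
  response u x = rm /\ response u (- x) = rp.
Proof.
move=> ru; have bu := ramp_bm _ ru; have [L HL] := ramp_far _ ru.
have [A [A0 KA]] := kernel_support.
exists (L + A) => x xL.
rewrite /response !(conv_near_constant A u) //.
- have [-> ->] := HL x ltac:(lra).
  rewrite !mulrA; split.
    by rewrite -ELm addrK lnK.
  by rewrite -ELp addrK lnK.
- move=> y /ler_normlP[h1 h2].
  have [_] := HL (- y) ltac:(lra); rewrite opprK => ->.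
  by have [_ ->] := HL x ltac:(lra).
- move=> y /ler_normlP[h1 h2].
  have [-> _] := HL y ltac:(lra).
  by have [-> _] := HL x ltac:(lra).
Qed.

Lemma response_nonincreasing u : nondecreasing_fun u -> bounded_measurable u ->
  nonincreasing_fun (response u).
Proof. by move=> ndu bu x y xy; rewrite ler_expR lerD2l lerN2 ler_pM2l// conv_nondecreasing. Qed.

Lemma response_nondecreasing u : nonincreasing_fun u -> bounded_measurable u ->
  nondecreasing_fun (response u).
Proof. by move=> ndu bu x y xy; rewrite ler_expR lerD2l lerN2 ler_pM2l// conv_nonincreasing. Qed.

Lemma ramp_response_bounds u : ramp u -> forall x, rm <= response u x <= rp.
Proof. by move=> ru; apply: response_bounds => //; [exact: ramp_bm|exact: ramp_bounds]. Qed.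

Lemma ramp_reflected_response u : ramp u -> ramp (S u).
Proof.
move=> ru; have bu := ramp_bm _ ru; split.
- move=> x y xy; rewrite !reflected_responseE; apply: (response_nonincreasing _ (ramp_nd _ ru) bu).
  by rewrite lerN2.
- by move=> x; rewrite reflected_responseE; exact: ramp_response_bounds.
- have [L HL] := ramp_far_response _ ru; exists L => x /HL[h1 h2].
  by rewrite reflected_response_opp reflected_responseE.
Qed.

Lemma ramp_response_bm u : ramp u -> bounded_measurable (response u).
Proof.
move=> ru; apply: (bm_nonincreasing _ rm rp); last exact: ramp_response_bounds.
exact: response_nonincreasing (ramp_nd _ ru) (ramp_bm _ ru).
Qed.

Lemma ramp_eventually_constant u : ramp u -> eventually_constant u.
Proof.
move=> ru; have [L HL] := ramp_far _ ru; exists L => x y [[xL yL]|[xL yL]].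
  by have [-> _] := HL _ xL; have [-> _] := HL _ yL.
have [_] := HL (- x) ltac:(lra); have [_] := HL (- y) ltac:(lra).
by rewrite !opprK => -> ->.
Qed.

Lemma ramp_response_eventually_constant u : ramp u -> eventually_constant (response u).
Proof.
move=> ru; have [L HL] := ramp_far_response _ ru; exists L => x y [[xL yL]|[xL yL]].
  by have [-> _] := HL _ xL; have [-> _] := HL _ yL.
have [_] := HL (- x) ltac:(lra); have [_] := HL (- y) ltac:(lra).
by rewrite !opprK => -> ->.
Qed.

Lemma bm_psi u : ramp u -> bounded_measurable (fun x => psi (u x)).
Proof.
move=> ru; have bu := ramp_bm _ ru.
apply: bmB; apply: bmM => //; last exact: bm_cst.
have pos x : 0 < u x by have /andP[h _] := ramp_bounds _ ru x; exact: lt_le_trans h.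
apply: (bm_nondecreasing _ (ln rm) (ln rp)).
  by move=> x y xy; rewrite ler_ln ?posrE//; exact: ramp_nd ru _ _ xy.
by move=> x; have /andP[h1 h2] := ramp_bounds _ ru x; rewrite !ler_ln ?posrE// h1.
Qed.

(** The excess free energy density of the pair (u, response u): for m = response u
    one has psi m + beta m (K * u) = - m. *)
Definition energy_density (u : R -> R) (x : R) : R := psi (u x) - response u x - g.

Definition energy (u : R -> R) : R := (\int[mu]_x energy_density u x)%R.

Let lnrm : ln rm = c - alpha * rp. Proof. by rewrite -ELm addrK. Qed.
Let lnrp : ln rp = c - alpha * rm. Proof. by rewrite -ELp addrK. Qed.

Lemma tf_energy_density u : ramp u -> test_fun (energy_density u).
Proof.
move=> ru; split.
  apply: bmB; last exact: bm_cst.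
  by apply: bmB; [exact: bm_psi|exact: ramp_response_bm].
have [L HL] := ramp_far _ ru; have [L' HL'] := ramp_far_response _ ru.
exists (Num.max L L') => x; rewrite gt_max => /andP[]; rewrite /energy_density.
case: (ger0P x) => x0 xL xL'.
  have [-> _] := HL _ xL; have [-> _] := HL' _ xL'.
  by rewrite /bulk /psi lnrm lnrp; ring.
have [_] := HL _ xL; have [_] := HL' _ xL'; rewrite !opprK => -> ->.
by rewrite /bulk /psi lnrm lnrp; ring.
Qed.

Lemma ln_response u x : ln (response u x) = c - beta * convolution K u x.
Proof. by rewrite /response expRK. Qed.

Lemma energy_density_bulk u x :
  energy_density u x - beta * (response u x * (convolution K u x - mass * u x))
  = bulk (u x) (response u x) - g.
Proof. by rewrite /energy_density /bulk /psi ln_response; ring. Qed.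

(** The energy exceeds its local part by beta times the interaction of two
    oppositely monotone profiles. *)
Lemma bulk_integral_le u : ramp u ->
  test_fun (fun x => bulk (u x) (response u x) - g) /\
  (\int[mu]_x (bulk (u x) (response u x) - g))%R <= energy u.
Proof.
move=> ru; have bu := ramp_bm _ ru; have br := ramp_response_bm _ ru.
have tI : test_fun (fun x => response u x * (convolution K u x - mass * u x)).
  by apply: tf_interaction => //; [left; exact: ramp_nd|exact: ramp_eventually_constant].
have tE := tf_energy_density _ ru.
have tbI := tfZ beta _ tI.
have E : (fun x => bulk (u x) (response u x) - g) = (fun x => energy_density u x
    - beta * (response u x * (convolution K u x - mass * u x))).
  by apply/funext => x; rewrite energy_density_bulk.
rewrite E; split; first exact: tfB.
rewrite tf_integralB// tf_integralZ// gerBl mulr_ge0 ?(ltW beta0)//.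
apply: interaction_ge0 => //.
- exact: response_nonincreasing (ramp_nd _ ru) bu.
- exact: ramp_nd ru.
- exact: ramp_eventually_constant.
Qed.

Lemma bulk_on_interval u (s t eta : R) : ramp u -> s <= t ->
  (forall x, s <= x <= t -> eta <= bulk (u x) (response u x) - g) ->
  eta * (t - s) <= energy u.
Proof.
move=> ru st H; have [tb] := bulk_integral_le _ ru; apply: le_trans.
apply: tf_integral_ge_segment => // x; rewrite subr_ge0; apply: bulk_min.
  by have /andP[h _] := ramp_bounds _ ru x; apply: le_trans h; exact: ltW.
by have /andP[h _] := ramp_response_bounds _ ru x; apply: le_trans h; exact: ltW.
Qed.

Lemma energy_ge0 u : ramp u -> 0 <= energy u.
Proof.
move=> ru; have := bulk_on_interval _ 0 0 0 ru (lexx 0); rewrite mul0r; apply=> x _.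
rewrite subr_ge0; apply: bulk_min.
  by have /andP[h _] := ramp_bounds _ ru x; apply: le_trans h; exact: ltW.
by have /andP[h _] := ramp_response_bounds _ ru x; apply: le_trans h; exact: ltW.
Qed.

Lemma reflected_response_twice u x : ramp u -> S (S u) x = response (response u) x.
Proof.
move=> ru; rewrite reflected_responseE.
have -> : S u = (fun y => response u (- y)).
  by apply/funext => y; rewrite reflected_responseE.
by rewrite response_opp ?opprK//; exact: ramp_response_bm.
Qed.

(** Replacing u by S (S u) in the pair (u, response u) is an exact minimization in
    the first component, so the gain is the integral of the entropy gap. To compare
    the two energies, the interaction energy has to be read as a function of u
    instead of response u, which is the symmetry [interaction_sym]. *)
Lemma energy_dissipation u : ramp u ->
  test_fun (fun x => (u x - S (S u) x) ^+ 2) /\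
  (\int[mu]_x (u x - S (S u) x) ^+ 2)%R <= 4 * rp * (energy u - energy (S u)).
Proof.
move=> ru; have bu := ramp_bm _ ru; have br := ramp_response_bm _ ru.
have rS := ramp_reflected_response _ ru; have rSS := ramp_reflected_response _ rS.
pose m := response u.
pose T1 x := m x * (convolution K u x - mass * u x).
pose T2 x := u x * (convolution K m x - mass * m x).
have tT1 : test_fun T1.
  by apply: tf_interaction => //; [left; exact: ramp_nd|exact: ramp_eventually_constant].
have tT2 : test_fun T2.
  apply: tf_interaction => //; last exact: ramp_response_eventually_constant.
  by right; exact: response_nonincreasing (ramp_nd _ ru) bu.
have tE := tf_energy_density _ ru.
have tES := tf_opp _ (tf_energy_density _ rS).
pose gap x := energy_density u x - energy_density (S u) (- x) - beta * (T1 x - T2 x).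
have tgap : test_fun gap by apply: tfB; [exact: tfB|apply: tfZ; exact: tfB].
have IT : (\int[mu]_x T1 x)%R = (\int[mu]_x T2 x)%R.
  apply: interaction_sym => //; first exact: ramp_response_eventually_constant.
  exact: ramp_eventually_constant.
have IE : (\int[mu]_x energy_density u x)%R = energy u := erefl.
have IS : (\int[mu]_x energy_density (S u) (- x))%R = energy (S u).
  exact: (tf_integral_opp (energy_density (S u)) (tf_energy_density _ rS)).
have Igap : (\int[mu]_x gap x)%R = energy u - energy (S u).
  rewrite (tf_integralB (fun x => energy_density u x - energy_density (S u) (- x))
    (fun x => beta * (T1 x - T2 x))); [|exact: tfB|by apply: tfZ; exact: tfB].
  rewrite (tf_integralZ _ (fun x => T1 x - T2 x)); last exact: tfB.
  rewrite (tf_integralB T1 T2 tT1 tT2) IT subrr mulr0 subr0.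
  by rewrite (tf_integralB _ _ tE tES) IS IE.
have gapE x : gap x = u x * ln (u x) - u x * ln (S (S u) x) - u x + S (S u) x.
  have SSx : response (S u) (- x) = S (S u) x by rewrite [RHS]reflected_responseE.
  have Sx : S u (- x) = m x by rewrite reflected_response_opp.
  have lSS : ln (S (S u) x) = c - beta * convolution K m x.
    by rewrite (reflected_response_twice _ _ ru) ln_response.
  have lm : ln (m x) = c - beta * convolution K u x by rewrite ln_response.
  by rewrite /gap /energy_density SSx Sx /T1 /T2 -/(m x) /psi lSS lm; ring.
have sq x : (u x - S (S u) x) ^+ 2 <= 4 * rp * gap x.
  rewrite gapE.
  have /andP[u1 u2] := ramp_bounds _ ru x; have /andP[s1 s2] := ramp_bounds _ rSS x.
  exact: (entropy_gap_quadratic _ _ _ (lt_le_trans rm0 s1) (lt_le_trans rm0 u1) s2 u2).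
have tsq : test_fun (fun x => (u x - S (S u) x) ^+ 2).
  have bd : bounded_measurable (fun x => u x - S (S u) x) by exact: (bmB _ _ bu (ramp_bm _ rSS)).
  split; first exact: (bmM _ _ bd bd).
  have [L HL] := ramp_far _ ru; have [L' HL'] := ramp_far _ rSS.
  exists (Num.max L L') => x; rewrite gt_max => /andP[].
  case: (ger0P x) => x0 xL xL'.
    by have [-> _] := HL _ xL; have [-> _] := HL' _ xL'; rewrite subrr expr0n.
  have [_] := HL _ xL; have [_] := HL' _ xL'; rewrite !opprK => -> ->.
  by rewrite subrr expr0n.
split; first exact: tsq.
rewrite -Igap -(tf_integralZ _ _ tgap); apply: (le_tf_integral _ _ tsq _ sq); exact: tfZ.
Qed.

Opaque energy energy_density.

Fixpoint relax (k : nat) : R -> R := if k is k'.+1 then S (relax k') else step_ramp.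

Lemma relaxS k : relax k.+1 = S (relax k).
Proof. by []. Qed.

Lemma ramp_relax k : ramp (relax k).
Proof. by elim: k => [|k IH]; [exact: ramp_step|exact: ramp_reflected_response]. Qed.

Opaque relax.

Lemma relax_lip k x y : `|relax k.+1 x - relax k.+1 y| <= response_lip * `|x - y|.
Proof.
rewrite relaxS !reflected_responseE; have rk := ramp_relax k.
have -> : `|x - y| = `|- x - - y| by rewrite -opprD normrN.
apply: response_lipschitz => //; first by left; exact: ramp_nd.
exact: ramp_bounds.
Qed.

Lemma energy_relax_decr k : energy (relax k.+1) <= energy (relax k).
Proof.
have [_] := energy_dissipation _ (ramp_relax k); rewrite -!relaxS => H.
rewrite -subr_ge0 -(@pmulr_rge0 _ (4 * rp)) ?mulr_gt0//; apply: le_trans H.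
by apply: Rintegral_ge0 => x _; exact: sqr_ge0.
Qed.

Lemma energy_relax_le_step k : energy (relax k) <= energy step_ramp.
Proof. by elim: k => [//|k]; apply: le_trans; exact: energy_relax_decr. Qed.

(** A nonincreasing sequence bounded below has increments tending to 0. *)
Lemma energy_increment_small (eta : R) : 0 < eta -> exists k0, forall k, (k0 <= k)%N ->
  energy (relax k) - energy (relax k.+1) < eta.
Proof.
move=> eta0; pose V := range (fun k => energy (relax k)).
have hV : has_inf V.
  split; first by exists (energy (relax 0)); exists 0%N.
  by exists 0 => _ [k _ <-]; exact/energy_ge0/ramp_relax.
have [_ [k0 _ <-] Hk0] := inf_adherent eta0 hV.
exists k0 => k kk0.
have h1 : energy (relax k) <= energy (relax k0).
  rewrite -(subnKC kk0); elim: (k - k0)%N => [|j IH]; first by rewrite addn0.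
  by rewrite addnS; exact: le_trans (energy_relax_decr _) IH.
have Vk : V (energy (relax k.+1)) by exists k.+1.
have h2 := ge_inf (proj2 hV) Vk.
apply: le_lt_trans (lerB h1 h2) _.
by rewrite ltrBlDl.
Qed.

Lemma relax_increment_small (e : R) : 0 < e -> exists k0, forall k x, (k0 <= k)%N ->
  `|relax k.+1 x - relax k.+3 x| < e.
Proof.
move=> e0.
pose C := 4 * (response_lip + response_lip + 1) * (4 * rp).
have C0 : 0 < C by rewrite !mulr_gt0// ltr_wpDl// addr_ge0.
have [k0 Hk0] := energy_increment_small (e ^+ 3 / C) (divr_gt0 (exprn_gt0 3 e0) C0).
exists k0 => k x kk0.
have [] := energy_dissipation _ (ramp_relax k.+1); rewrite -!relaxS => tsq diss.
have dL y z : `|(relax k.+1 y - relax k.+3 y) - (relax k.+1 z - relax k.+3 z)|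
    <= (response_lip + response_lip) * `|y - z|.
  rewrite subr_exchange; apply: le_trans (ler_normB _ _) _; rewrite mulrDl.
  exact: lerD (relax_lip _ _ _) (relax_lip _ _ _).
have := lipschitz_square_integral _ _ x (addr_ge0 response_lip_ge0 response_lip_ge0) dL tsq.
move=> cube; rewrite ltNge; apply/negP => ge_e.
have e3 : e ^+ 3 <= `|relax k.+1 x - relax k.+3 x| ^+ 3.
  by apply: lerXn2r; rewrite ?nnegrE// ltW.
have := Hk0 k.+1 (leq_trans kk0 (leqnSn k)); rewrite ltr_pdivlMr// mulrC.
have L1 : 0 <= 4 * (response_lip + response_lip + 1) by rewrite mulr_ge0// !addr_ge0.
have := ler_wpM2l L1 diss.
move: (energy (relax k.+1) - energy (relax k.+2)) => X d1.
apply/negP; rewrite -leNgt.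
apply: (le_trans e3); apply: (le_trans cube); apply: (le_trans d1).
by rewrite /C -!mulrA.
Qed.

(** The difference of the two sides is rm - rp far to the left and rp - rm far to
    the right. *)
Lemma relax_crossing k : exists b, relax k.+2 b = relax k.+1 (- b).
Proof.
have r1 := ramp_relax k.+1; have r2 := ramp_relax k.+2.
have [L1 H1] := ramp_far _ r1; have [L2 H2] := ramp_far _ r2.
have [X [X0 XL1 XL2]] : exists X : R, [/\ 0 < X, L1 < X & L2 < X].
  exists (`|L1| + `|L2| + 1); have := ler_norm L1; have := ler_norm L2.
  have := normr_ge0 L1; have := normr_ge0 L2 => *; split; lra.
have [p1 q1] := H1 X XL1; have [p2 q2] := H2 X XL2.
pose phi x := relax k.+2 x - relax k.+1 (- x).
have XX : - X <= X by rewrite ge0_cp ?ltW.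
have phil : phi (- X) <= 0 by rewrite /phi opprK p1 q2 subr_le0 ltW.
have phir : 0 <= phi X by rewrite /phi p2 q1 subr_ge0 ltW.
have cphi : {within `[- X, X], continuous phi}.
  apply: continuous_subspaceT.
  apply: (lipschitz_continuous phi (response_lip + response_lip)) => x y.
  rewrite /phi subr_exchange; apply: le_trans (ler_normB _ _) _; rewrite mulrDl.
  apply: lerD; first exact: relax_lip.
  by have := relax_lip k (- x) (- y); rewrite -opprD normrN.
have [|b _ E] := IVT (v := 0) XX cphi.
  apply/andP; split; first by rewrite ge_min; apply/orP; left; exact: phil.
  by rewrite le_max; apply/orP; right; exact: phir.
by exists b; apply/eqP; rewrite -subr_eq0; apply/eqP.
Qed.

Lemma response_near (A e : R) (h1 h2 : R -> R) (x : R) :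
  (forall s : R, A < `|s| -> K s = 0) -> 0 <= e ->
  bounded_measurable h1 -> bounded_measurable h2 ->
  (forall y, rm <= h1 y <= rp) -> (forall y, rm <= h2 y <= rp) ->
  (forall y, `|x - y| <= A -> `|h1 y - h2 y| <= e) ->
  `|response h1 x - response h2 x| <= rp * (alpha * e).
Proof.
move=> KA e0.
suff H f1 f2 : bounded_measurable f1 -> bounded_measurable f2 ->
    (forall y, rm <= f1 y <= rp) -> (forall y, `|x - y| <= A -> `|f1 y - f2 y| <= e) ->
    response f1 x - response f2 x <= rp * (alpha * e).
  move=> b1 b2 r1 r2 cl; rewrite ler_norml (H h1 h2)// andbT lerNl opprB H//.
  by move=> y /cl; rewrite distrC.
move=> b1 b2 r1 cl; apply: le_trans (response_sub _ _ _ b1 b2) _.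
have /andP[s1 s2] := response_bounds _ b1 r1 x.
have C : convolution K (fun y => f2 y - f1 y) x <= mass * e.
  rewrite -(conv_cst e x); apply: (conv_local _ _ _ _ KA).
  - exact: bmB.
  - exact: bm_cst.
  - by move=> y /cl; rewrite distrC; apply: le_trans; exact: ler_norm.
have bC : beta * convolution K (fun y => f2 y - f1 y) x <= alpha * e.
  by rewrite -mulrA ler_pM2l.
apply: (@le_trans _ _ (response f1 x * (alpha * e))).
  by rewrite ler_wpM2l// (le_trans (ltW rm0) s1).
by rewrite ler_wpM2r// mulr_ge0// ltW.
Qed.

(** * Existence of a centred front *)

(** By convexity the slope of psi is at most its derivative ln s - c at s, and on
    [rm, rp] the Euler-Lagrange equations of the two phases bound it by alpha * rp. *)
Lemma psi_lipschitz s a : rm <= s <= rp -> rm <= a <= rp ->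
  psi s - psi a <= alpha * rp * `|s - a|.
Proof.
move=> /andP[s1 s2] /andP[a1 a2].
have s0 := lt_le_trans rm0 s1; have a0 := lt_le_trans rm0 a1.
have H := le_trans (sqr_ge0 _) (entropy_gap _ _ s0 a0).
apply: (@le_trans _ _ ((s - a) * (ln s - c))); first by rewrite /psi; lra.
apply: le_trans (ler_norm _) _; rewrite normrM mulrC; apply: ler_wpM2r => //.
have l1 : ln rm <= ln s by rewrite ler_ln ?posrE.
have l2 : ln s <= ln rp by rewrite ler_ln ?posrE.
have := mulr_gt0 alpha0 rm0; have := mulr_gt0 alpha0 rp0.
have := ELm; have := ELp.
set A1 := alpha * rm; set A2 := alpha * rp => E1 E2 p1 p2.
rewrite ler_norml; apply/andP; split; lra.
Qed.

Lemma bulk_lipschitz s t a b : rm <= s <= rp -> rm <= t <= rp ->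
  rm <= a <= rp -> rm <= b <= rp ->
  bulk a b - bulk s t <= 2 * (alpha * rp) * (`|a - s| + `|b - t|).
Proof.
move=> hs ht ha hb.
have H1 := psi_lipschitz _ _ ha hs; have H2 := psi_lipschitz _ _ hb ht.
have H3 : alpha * a * b - alpha * s * t <= alpha * rp * (`|a - s| + `|b - t|).
  have -> : alpha * a * b - alpha * s * t = alpha * (b * (a - s) + s * (b - t)) by ring.
  rewrite -[leRHS]mulrA ler_pM2l// [leRHS]mulrDr.
  have pos x : rm <= x <= rp -> 0 <= x by case/andP=> h _; exact: le_trans (ltW rm0) h.
  apply: lerD; apply: le_trans (ler_norm _) _; rewrite normrM ler_wpM2r// ger0_norm ?pos//.
    by case/andP: hb.
  by case/andP: hs.
have -> : 2 * (alpha * rp) * (`|a - s| + `|b - t|) = alpha * rp * `|a - s|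
  + alpha * rp * `|b - t| + alpha * rp * (`|a - s| + `|b - t|) by ring.
have -> : bulk a b - bulk s t = (psi a - psi s) + (psi b - psi t)
  + (alpha * a * b - alpha * s * t) by rewrite /bulk; ring.
exact: lerD (lerD H1 H2) H3.
Qed.

Opaque response bulk.

(** Let a and b be the limits of p and q at +oo. If bulk a b were above its minimum,
    then the approximants would have an excess density bounded below on intervals
    of arbitrary length, against the uniform bound C. So (a, b) is one of the two
    phases, and a <= p 0 = q 0 <= b selects (rm, rp). *)
Lemma tail_limit (p q : R -> R) (P Q : nat -> R -> R) (C : R) :
  nonincreasing_fun p -> nondecreasing_fun q -> p 0 = q 0 ->
  (forall x, rm <= p x <= rp) -> (forall x, rm <= q x <= rp) ->
  (forall k x, rm <= P k x <= rp) -> (forall k x, rm <= Q k x <= rp) ->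
  (forall X e : R, 0 < e -> exists k, forall x, `|x| <= X ->
     `|P k x - p x| < e /\ `|Q k x - q x| < e) ->
  (forall k (s t eta : R), s <= t ->
     (forall x, s <= x <= t -> eta <= bulk (P k x) (Q k x) - g) -> eta * (t - s) <= C) ->
  forall e, 0 < e -> (exists X, p X < rm + e) /\ (exists X, rp - e < q X).
Proof.
move=> pni qnd pq0 pb qb Pb Qb close en.
have hp : has_inf (range p).
  by split; [exists (p 0), 0|exists rm => _ [x _ <-]; case/andP: (pb x)].
have hq : has_sup (range q).
  by split; [exists (q 0), 0|exists rp => _ [x _ <-]; case/andP: (qb x)].
pose a := inf (range p); pose b := sup (range q).
have pa x : a <= p x by apply: (ge_inf (proj2 hp)); exists x.
have qb' x : q x <= b by apply: (ub_le_sup (proj2 hq)); exists x.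
have a1 : rm <= a.
  by apply: lb_le_inf (proj1 hp) _ => _ [x _ <-]; case/andP: (pb x).
have a2 : a <= rp by apply: le_trans (pa 0) _; case/andP: (pb 0).
have b2 : b <= rp.
  by apply: ge_sup (proj1 hq) _ => _ [x _ <-]; case/andP: (qb x).
have b1 : rm <= b by apply: le_trans _ (qb' 0); case/andP: (qb 0).
have limp e : 0 < e -> exists X, p X < a + e.
  by move=> e0; have [_ [X _ <-] HX] := inf_adherent e0 hp; exists X.
have limq e : 0 < e -> exists X, b - e < q X.
  by move=> e0; have [_ [X _ <-] HX] := sup_adherent e0 hq; exists X.
have a0 := le_trans (ltW rm0) a1; have b0 := le_trans (ltW rm0) b1.
have bg : bulk a b <= g.
  rewrite leNgt; apply/negP => gap.
  pose eta := (bulk a b - g) / 2.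
  have eta0 : 0 < eta by rewrite divr_gt0// subr_gt0.
  pose W := 2 * (alpha * rp).
  have W0 : 0 < W by apply: mulr_gt0 => //; exact: mulr_gt0.
  (* P k x and Q k x are within 2 d of a and b, and bulk is W-Lipschitz. *)
  pose d := eta / (4 * W).
  have d0 : 0 < d by rewrite divr_gt0// mulr_gt0.
  have dE : W * (4 * d) = eta by rewrite /d; field; rewrite lt0r_neq0.
  have [X1 HX1] := limp _ d0; have [X2 HX2] := limq _ d0.
  pose X0 := Num.max 0 (Num.max X1 X2).
  have [X00 X01 X02] : [/\ 0 <= X0, X1 <= X0 & X2 <= X0].
    by split; rewrite /X0 !le_max !lexx ?orbT.
  have C0 : 0 <= C.
    have := en 0%N 0 0 0 (lexx 0); rewrite mul0r; apply=> x _.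
    rewrite subr_ge0; apply: bulk_min.
      by have /andP[h _] := Pb 0%N x; apply: le_trans h; exact: ltW.
    by have /andP[h _] := Qb 0%N x; apply: le_trans h; exact: ltW.
  (* On an interval of length l an excess eta costs C + 1. *)
  pose l := (C + 1) / eta.
  have l0 : 0 <= l by rewrite divr_ge0 ?addr_ge0// ltW.
  have [k Hk] := close (X0 + l) d d0.
  suff : eta * (X0 + l - X0) <= C.
    rewrite [X0 + l]addrC addrK /l mulrC divfK ?lt0r_neq0//; lra.
  apply: (en k); first by rewrite lerDl.
  move=> x /andP[x1 x2].
  have [cp cq] := Hk x ltac:(by rewrite ger0_norm//; exact: le_trans X00 x1).
  have px : p x <= p X1 by apply: pni; exact: le_trans x1.
  have qx : q X2 <= q x by apply: qnd; exact: le_trans x1.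
  have := bulk_lipschitz _ _ a b (Pb k x) (Qb k x).
  rewrite a1 a2 b1 b2 => /(_ erefl erefl) BL.
  have ap : `|a - P k x| <= 2 * d.
    have := pa x; move: cp; rewrite ltr_norml ler_norml => /andP[? ?] ?.
    by apply/andP; split; lra.
  have bq : `|b - Q k x| <= 2 * d.
    have := qb' x; move: cq; rewrite ltr_norml ler_norml => /andP[? ?] ?.
    by apply/andP; split; lra.
  have : W * (`|a - P k x| + `|b - Q k x|) <= W * (4 * d).
    by rewrite ler_pM2l//; lra.
  rewrite dE => BL2; have B3 := le_trans BL BL2.
  have eE : bulk a b - g = 2 * eta by rewrite /eta mulrC divfK.
  lra.
have [[ea eb]|[ea eb]] := bulk_argmin _ _ a0 b0 bg.
  by exfalso; have := rmrp; have := pa 0; have := qb' 0; rewrite ea eb pq0; lra.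
move=> e e0; split; [rewrite -ea; exact: limp|rewrite -eb; exact: limq].
Qed.

(** N k and response (N k) are the two components of an approximate solution,
    centred at 0. The behaviour at -oo is that of the reflected pair at +oo. *)
Lemma front_from_approximants (N : nat -> R -> R) (C : R) :
  (forall k, nonincreasing_fun (N k)) -> (forall k x, rm <= N k x <= rp) ->
  (forall k x y, `|N k x - N k y| <= response_lip * `|x - y|) ->
  (forall k, response (N k) 0 = N k 0) ->
  (forall e : R, 0 < e -> exists k0, forall k x, (k0 <= k)%N ->
     `|N k x - response (response (N k)) x| < e) ->
  (forall k (s t eta : R), s <= t ->
     (forall x, s <= x <= t -> eta <= bulk (N k x) (response (N k) x) - g) ->
     eta * (t - s) <= C) ->
  exists m n, front m n /\ m 0 = n 0.
Proof.
move=> Nni Nb NL N0 Nres Nen.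
have [A [A0 KA]] := kernel_support.
have [n Hn] := locally_uniform_limit_point N rm rp response_lip Nb response_lip_ge0 NL.
have at1 (x e : R) : 0 < e -> exists k, `|N k x - n x| < e.
  by move=> e0; have [k [_ Hk]] := Hn `|x| e 0%N e0; exists k; exact: Hk.
have at2 (x y e : R) : 0 < e -> exists k, `|N k x - n x| < e /\ `|N k y - n y| < e.
  move=> e0; have [k [_ Hk]] := Hn (Num.max `|x| `|y|) e 0%N e0.
  by exists k; split; apply: Hk; rewrite le_max lexx ?orbT.
have nb x : rm <= n x <= rp.
  apply/andP; split; apply/ler_addgt0Pr => e e0; have [k] := at1 x e e0;
    have /andP[h1 h2] := Nb k x; rewrite ltr_norml => /andP[]; lra.
have nni : nonincreasing_fun n.
  move=> x y xy; apply/ler_addgt0Pr => e e0.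
  have [k []] := at2 x y (e / 2) (divr_gt0 e0 (ltr0n _ 2)).
  have := Nni k _ _ xy; rewrite !ltr_norml => ? /andP[? ?] /andP[? ?]; lra.
have Nbm k := bm_nonincreasing _ _ _ (Nni k) (Nb k).
have nbm := bm_nonincreasing _ _ _ nni nb.
pose m := response n; pose M k := response (N k).
have rb h : bounded_measurable h -> (forall x, rm <= h x <= rp) ->
    forall x, rm <= response h x <= rp by move=> bh hb; exact: response_bounds.
have Mb k := rb _ (Nbm k) (Nb k).
have mb := rb _ nbm nb.
have mnd : nondecreasing_fun m.
  by apply: response_nondecreasing.
have Mnd k : nondecreasing_fun (M k) by apply: response_nondecreasing.
have Mbm k := bm_nondecreasing _ _ _ (Mnd k) (Mb k).
have mbm := bm_nondecreasing _ _ _ mnd mb.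
pose W := rp * alpha + 1.
have ra0 : 0 < rp * alpha by rewrite mulr_gt0.
have W1 : 0 < W by rewrite /W addr_gt0.
have close (X e : R) (k0 : nat) : 0 < e -> exists k, (k0 <= k)%N /\
    forall x, `|x| <= X -> `|N k x - n x| < e /\ `|M k x - m x| < e.
  move=> e0; pose e' := e / W.
  have e'0 : 0 < e' by rewrite divr_gt0.
  have eW : e = rp * alpha * e' + e'.
    by rewrite /e' -[X in _ + X]mul1r -mulrDl mulrC divfK ?lt0r_neq0.
  have [k [kk0 Hk]] := Hn (X + A) e' k0 e'0; exists k; split=> // x xX; split.
    apply: lt_le_trans (Hk x _) _; first by lra.
    by rewrite eW lerDr mulr_ge0// ltW.
  apply: le_lt_trans (_ : _ <= rp * (alpha * e')) _; last by rewrite eW mulrA ltrDl.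
  apply: (response_near A) => //; first exact: ltW.
  move=> y xy; apply/ltW/Hk.
  have := ler_normB x (x - y); rewrite subKr; lra.
have eq2 x : n x = response m x.
  apply/eqP; rewrite -subr_eq0 -normr_le0; apply/ler_addgt0Pr => e e0; rewrite add0r.
  pose e' := e / (W + 1).
  have W2 : 0 < W + 1 by rewrite addr_gt0.
  have e'0 : 0 < e' by rewrite divr_gt0.
  have eW : e = e' + e' + rp * (alpha * e').
    have -> : e' + e' + rp * (alpha * e') = e' * (W + 1) by rewrite /W; ring.
    by rewrite /e' divfK ?lt0r_neq0.
  have [k0 Hk0] := Nres e' e'0.
  have [k [kk0 Hk]] := close (`|x| + A) e' k0 e'0.
  have t1 := Hk0 k x kk0.
  have [t2 _] := Hk x ltac:(lra).
  have t3 : `|response (M k) x - response m x| <= rp * (alpha * e').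
    apply: (response_near A e' (M k) m x KA
      (ltW e'0) (Mbm k) mbm (Mb k) mb) => y xy.
    have [] := Hk y; last by move=> _ /ltW.
    have := ler_normB x (x - y); rewrite subKr; lra.
  rewrite eW; apply: le_trans (ler_distD (response (M k) x) _ _) _; apply: lerD t3.
  apply: le_trans (ler_distD (N k x) _ _) _; rewrite (distrC (n x)).
  exact: lerD (ltW t2) (ltW t1).
have mn0 : m 0 = n 0.
  apply/eqP; rewrite -subr_eq0 -normr_le0; apply/ler_addgt0Pr => e e0; rewrite add0r.
  have [k [_ Hk]] := close 0 (e / 2) 0%N (divr_gt0 e0 (ltr0n _ 2)).
  have [] := Hk 0 ltac:(by rewrite normr0); rewrite /M N0.
  by rewrite !ltr_norml ler_norml => /andP[? ?] /andP[? ?]; apply/andP; split; lra.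
have right := tail_limit n m N M C nni mnd (esym mn0) nb mb Nb Mb
  (fun X e e0 => let: ex_intro k (conj _ Hk) := close X e 0%N e0 in ex_intro _ k Hk) Nen.
have left : forall e, 0 < e -> (exists X, m (- X) < rm + e) /\ (exists X, rp - e < n (- X)).
  apply: (tail_limit (fun x => m (- x)) (fun x => n (- x)) (fun k x => M k (- x))
    (fun k x => N k (- x)) C).
  - by move=> x y xy; apply: mnd; rewrite lerN2.
  - by move=> x y xy; apply: nni; rewrite lerN2.
  - by rewrite oppr0.
  - by move=> x; exact: mb.
  - by move=> x; exact: nb.
  - by move=> k x; exact: Mb.
  - by move=> k x; exact: Nb.
  - move=> X e e0; have [k [_ Hk]] := close X e 0%N e0; exists k => x xX.
    by have [] := Hk (- x) ltac:(by rewrite normrN).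
  - move=> k s t eta st H.
    have st' : - t <= - s by rewrite lerN2.
    have := Nen k (- t) (- s) eta st'; rewrite opprK (addrC (- s)); apply=> x /andP[x1 x2].
    have := H (- x); rewrite opprK bulkC; apply; apply/andP; split; lra.
exists m, n; split; last exact: mn0.
apply: (Front _ _ mnd nni mb nb) => //.
- by move=> e /left[[X HX] _]; exists (- X).
- by move=> e /right[_ [X HX]]; exists X.
- by move=> e /right[[X HX] _]; exists X.
- by move=> e /left[_ [X HX]]; exists (- X).
Qed.

Lemma front_exists : exists m n, front m n /\ m 0 = n 0.
Proof.
pose u := relax.
have rk k : ramp (u k) by exact: ramp_relax.
have [b Hb] : exists b : nat -> R, forall k, u k.+2 (b k) = u k.+1 (- b k).
  have [b Hb] := choice relax_crossing.
  by exists b => k; exact: Hb.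
have Su k x : response (u k) x = u k.+1 (- x).
  by rewrite /u relaxS reflected_response_opp.
have ulip k x y : `|u k.+1 x - u k.+1 y| <= response_lip * `|x - y|.
  exact: relax_lip.
have small (e : R) : 0 < e -> exists k0, forall k x, (k0 <= k)%N -> `|u k.+1 x - u k.+3 x| < e.
  exact: relax_increment_small.
have [C bound] : exists C, forall k (s t eta : R), s <= t ->
    (forall x, s <= x <= t -> eta <= bulk (u k x) (response (u k) x) - g) ->
    eta * (t - s) <= C.
  exists (energy step_ramp) => k s t eta st H.
  apply: le_trans (energy_relax_le_step k).
  exact: (bulk_on_interval _ _ _ _ (rk k) st H).
clearbody u.
have bu k : bounded_measurable (u k) by exact: ramp_bm (rk k).
have ubo k : bounded_measurable (fun x => u k (- x)) by exact: bm_opp.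
pose N k x := u k.+1 (- (x + b k)).
have MN k x : response (N k) x = u k.+2 (x + b k).
  have := response_shift (fun y => u k.+1 (- y)) (b k) x (ubo k.+1).
  by rewrite response_opp// Su opprK.
have NN k x : response (response (N k)) x = u k.+3 (- (x + b k)).
  have -> : response (N k) = fun x => u k.+2 (x + b k) by apply/funext => y; rewrite MN.
  by rewrite (response_shift (u k.+2) (b k))// Su.
apply: (front_from_approximants N C).
- by move=> k x y xy; apply: (ramp_nd _ (rk k.+1)); rewrite lerN2 lerD2r.
- by move=> k x; exact: ramp_bounds (rk k.+1) _.
- move=> k x y; have := ulip k (- (x + b k)) (- (y + b k)).
  by rewrite -opprD normrN (_ : x + b k - (y + b k) = x - y)//; ring.
- by move=> k; rewrite MN /N add0r; exact: Hb.
- move=> e /small[k0 Hk0].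
  by exists k0 => k x kk0; rewrite NN; exact: Hk0.
- move=> k s t eta st H.
  have -> : t - s = - (s + b k) - - (t + b k) by ring.
  apply: (bound k.+1); first by rewrite lerN2 lerD2r.
  move=> x /andP[x1 x2].
  have := H (- x - b k); rewrite MN /N !subrK opprK Su; apply.
  by apply/andP; split; lra.
Qed.

End fronts.

(** * The planar kernel and the theorem *)

Section planar_kernel.
Context {R : realType}.
Notation mu := (@lebesgue_measure R).
Notation T := (measurableTypeR R).

(** By induction on the dimension, the box being a product. *)
Lemma box_finite_measure (k : nat) (a : R) : exists B : set (k.-tuple T),
  [/\ measurable B, (lebesgue_tuple k B < +oo)%E &
      forall t : k.-tuple T, (forall i, `|tnth t i : R| <= a) -> B t].
Proof.
elim: k => [|k [B [mB Boo BP]]].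
  by exists setT; split => //; rewrite /= diracT ltry.
pose C : set (k.+1.-tuple T) :=
  (fun t : k.+1.-tuple T => thead t) @^-1` `[- a, a]%classic `&`
  (fun t : k.+1.-tuple T => [tuple of behead t]) @^-1` B.
have mC : measurable C.
  apply: measurableI; rewrite -[X in measurable X]setTI.
    by apply: measurable_tnth => //; exact: measurable_itv.
  by apply: measurable_behead.
exists C; split=> //.
- rewrite /= /lebesgue_cons /pushforward.
  have -> : @cons_pair R k @^-1` C = `[- a, a]%classic `*` B.
    apply/seteqP; split => -[x t] /=; rewrite /C /= theadE => -[h1 h2]; split=> //.
      by move: h2; congr B; apply/val_inj.
    by move: h2; congr B; apply/val_inj.
  rewrite product_measure1E//.
  rewrite lte_mul_pinfty//.
  change (mu `[- a, a]%classic \is a fin_num).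
  by rewrite /= lebesgue_measure_itv/=; case: ifP.
- move=> t ta; split => /=.
    by rewrite in_itv/= -ler_norml; exact: ta.
  by apply: BP => i; rewrite tnth_behead; exact: ta.
Qed.

Lemma tuple_integrable (k : nat) (a M : R) (f : k.-tuple T -> R) :
  measurable_fun setT f -> (forall t, `|f t| <= M) ->
  (forall t i, a < `|tnth t i : R| -> f t = 0) ->
  (lebesgue_tuple k).-integrable setT (EFin \o f).
Proof.
move=> mf fM fa; have [B [mB Boo BP]] := box_finite_measure k a.
apply: (bounded_support_integrable _ _ (lebesgue_tuple k) B M) => // t nB.
apply: contrapT => ft; apply: nB; apply: BP => i.
by rewrite leNgt; apply/negP => /fa.
Qed.

(** Up to the argument s^2, Jbar is an integral of H(s^2 + |t|^2) with H
    nonincreasing. The cut-off Num.max r 0 makes G monotone on the whole line, hence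
    measurable. *)
Lemma Jbar_unimodal (J : R -> R) (nu : nat) : admissible_kernel J ->
  unimodal_kernel (Jbar J nu).
Proof.
move=> [J0 Jdec [A0 JA0]].
pose k := nu.-1.
have [A [A_gt0 JA]] : exists A : R, 0 < A /\ forall r, A < r -> J r = 0.
  exists (`|A0| + 1); split; first by rewrite ltr_wpDl.
  move=> r rA; have := ler_norm A0; have := normr_ge0 A0 => *; apply: JA0; lra.
pose H (r : R) := J (Num.sqrt r).
have Hni : nonincreasing_fun H.
  move=> x y xy; apply: Jdec; rewrite ?in_itv/= ?sqrtr_ge0//; exact: ler_wsqrtr.
have H0 r : 0 <= H r by apply: J0; exact: sqrtr_ge0.
pose Q (t : k.-tuple T) : R := \sum_(i < k) (tnth t i : R) ^+ 2.
have Q0 t : 0 <= Q t by apply: sumr_ge0 => i _; exact: sqr_ge0.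
have mQ : measurable_fun setT Q.
  apply: measurable_sum => i; apply: measurable_funX; exact: measurable_tnth.
have tQ t i : (tnth t i : R) ^+ 2 <= Q t.
  by rewrite /Q (bigD1 i)//= lerDl; apply: sumr_ge0 => j _; exact: sqr_ge0.
pose F (r : R) (t : k.-tuple T) := H (Num.max r 0 + Q t).
have Hfar (r : R) : A ^+ 2 < r -> H r = 0.
  move=> rA; apply: JA; rewrite -(ger0_norm (ltW A_gt0)) -sqrtr_sqr ltr_sqrt//.
  by apply: le_lt_trans rA; exact: sqr_ge0.
have max0 (r : R) : 0 <= Num.max r 0 by rewrite le_max lexx orbT.
have iF r : (lebesgue_tuple k).-integrable setT (EFin \o F r).
  apply: (tuple_integrable k A (H 0)).
  - apply: (measurableT_comp (nonincreasing_measurable measurableT Hni)).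
    by apply: measurable_funD => //; exact: measurable_cst.
  - by move=> t; rewrite ger0_norm ?H0//; apply: Hni; exact: addr_ge0.
  - move=> t i ti; apply: Hfar; apply: (@lt_le_trans _ _ ((tnth t i : R) ^+ 2)).
      rewrite -[ltRHS](real_normK (num_real _)).
      by rewrite ltrXn2r// ltW.
    by rewrite (le_trans (tQ t i))// lerDr.
pose G (r : R) : R := (\int[lebesgue_tuple k]_t F r t)%R.
have Gni : nonincreasing_fun G.
  move=> x y xy; apply: le_Rintegral => // t _; apply: Hni.
  by rewrite lerD2r ge_max !le_max xy lexx !orbT.
have G0 r : 0 <= G r by apply: Rintegral_ge0 => t _; exact: H0.
have JG (s : R) : Jbar J nu s = G (s ^+ 2).
  apply: eq_Rintegral => t _; rewrite /F /H /Q.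
  by have /max_idPl -> : 0 <= s ^+ 2 by exact: sqr_ge0.
have JGE : Jbar J nu = fun s => G (s ^+ 2) by apply/funext.
have Gmeas : measurable_fun setT G by exact: nonincreasing_measurable.
split.
- rewrite JGE; split; [split|].
  + by apply: (measurableT_comp Gmeas); exact: exprn_measurable.
  + by exists (G 0) => s; rewrite ger0_norm// Gni// sqr_ge0.
  + exists A => s sA; rewrite /G.
    have -> : F (s ^+ 2) = fun=> 0.
      apply/funext => t; apply: Hfar.
      apply: (@lt_le_trans _ _ (s ^+ 2)).
        by rewrite -[ltRHS](real_normK (num_real _)) ltrXn2r// ltW.
      have /max_idPl -> : 0 <= s ^+ 2 by exact: sqr_ge0.
      by rewrite lerDl.
    by rewrite /Rintegral integral0.
- by move=> s; rewrite JG.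
- by move=> s; rewrite !JG sqrrN.
- by move=> s t s0 st; rewrite !JG; apply: Gni; rewrite lerXn2r// nnegrE// (le_trans s0).
Qed.

End planar_kernel.

Theorem theorem7p1 (R : realType) (nu : nat) (hnu : (1 <= nu)%N)
    (J : R -> R) (hJ : admissible_kernel J)
    (kappa beta betac rhom rhop : R)
    (hbeta : 0 < beta)
    (hbetac : critical_beta J nu kappa betac)
    (hsup : betac < beta)
    (hrho : two_phase_densities J nu kappa beta rhom rhop) :
  [/\ forall w v : (R -> R) * (R -> R),
        critical_point J nu kappa beta rhom rhop w ->
        critical_point J nu kappa beta rhom rhop v ->
        exists a : R, forall x : R, (v.1 x, v.2 x) = (w.1 (x - a), w.2 (x - a)),
      exists! w : (R -> R) * (R -> R),
        critical_point J nu kappa beta rhom rhop w /\ w.1 0 = w.2 0 &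
      forall w : (R -> R) * (R -> R),
        critical_point J nu kappa beta rhom rhop w -> w.1 0 = w.2 0 ->
        forall x : R, w.1 x = w.2 (- x)].
Proof.
have uK := Jbar_unimodal J nu hJ.
have [rmp ELp ELm alpha0 stable] := two_phase_euler_lagrange J nu kappa beta rhom rhop hrho.
set K := Jbar J nu in uK.
have fE (s t : R) : free_energy J nu kappa beta s t = bulk K beta (kappa - 1) s t.
  by rewrite /free_energy /bulk /psi /Jhat -/K; ring.
have [_ minP] := hrho.
have [mp mm mmin] : minimizer J nu kappa beta (rhop, rhom) by apply/minP; left.
have bulk_min (s t : R) : 0 <= s -> 0 <= t ->
    bulk K beta (kappa - 1) rhop rhom <= bulk K beta (kappa - 1) s t.
  by move=> s0 t0; rewrite -!fE; exact: mmin.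
have bulk_argmin (s t : R) : 0 <= s -> 0 <= t ->
    bulk K beta (kappa - 1) s t <= bulk K beta (kappa - 1) rhop rhom ->
    (s = rhop /\ t = rhom) \/ (s = rhom /\ t = rhop).
  move=> s0 t0; rewrite -!fE => H.
  have /minP : minimizer J nu kappa beta (s, t).
    by split=> //= m n m0 n0; apply: (le_trans H); exact: mmin.
  by case=> -[-> ->]; [left|right].
have crit w : critical_point J nu kappa beta rhom rhop w <->
    front K beta (kappa - 1) rhom rhop w.1 w.2.
  split; first by case=> h1 h2 h3; exact: front_of_profiles.
  by move/(profiles_of_front K uK beta (kappa - 1) rhom rhop hbeta rmp ELp ELm).
have uniq := front_unique K uK beta (kappa - 1) rhom rhop hbeta rmp ELp ELm alpha0 stable.
have centered (v1 v2 w1 w2 : R -> R) : front K beta (kappa - 1) rhom rhop v1 v2 ->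
    front K beta (kappa - 1) rhom rhop w1 w2 -> v1 0 = v2 0 -> w1 0 = w2 0 ->
    forall x, v1 x = w1 x /\ v2 x = w2 x.
  move=> fv fw v0 w0; have [a Ha] := uniq _ _ _ _ fv fw.
  have a0 : a = 0.
    apply: (front_crossing_unique K uK beta (kappa - 1) rhom rhop hbeta rmp ELp ELm alpha0
      w1 w2) => //.
    by have [h1 h2] := Ha 0; rewrite add0r in h1 h2; rewrite -h1 -h2.
  by move=> x; have := Ha x; rewrite a0 addr0.
split.
- move=> w v /crit fw /crit fv; have [a Ha] := uniq _ _ _ _ fv fw.
  by exists (- a) => x; rewrite opprK; have [-> ->] := Ha x.
- have [m [n [fr mn0]]] := front_exists K uK beta (kappa - 1) rhom rhop hbeta rmp ELp ELm alpha0
    bulk_min bulk_argmin.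
  exists (m, n); split; first by split=> //; apply/crit.
  move=> [w1 w2] [/crit /= fw w0].
  by congr pair; apply/funext => x; have [] := centered _ _ _ _ fr fw mn0 w0 x.
- move=> [w1 w2] /crit /= fw w0 x.
  have ff := front_flip K uK beta (kappa - 1) rhom rhop hbeta rmp ELp ELm _ _ fw.
  have [] := centered _ _ _ _ fw ff w0 _ x => //.
  by rewrite oppr0.
Qed.
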